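(* Let $\Gamma$ be a countable group. Then: (1) the extremal models of $\mathrm{PMP}_\Gamma$ are exactly the ergodic systems; (2) the affine theory $\mathrm{PMP}_\Gamma$ is simplicial.
   Context: Work in affine logic (fragment of continuous logic with formulas built from atomic ones by real affine combinations and $\sup,\inf$). The language of probability algebras is $\{\mu,\cup,\cap,\neg,\mathbf 0,\mathbf 1\}$ with metric $d(a,b)=\mu(a\triangle b)$; its models satisfying the (affine) axioms of Boolean algebras, $\mu(\mathbf 1)=1$ and $\mu(x\cup y)+\mu(x\cap y)=\mu(x)+\mu(y)$ are the measure algebras of probability spaces. $\mathcal L_\Gamma$ adds a unary function symbol for each $\gamma\in\Gamma$, and $\mathrm{PMP}_\Gamma$ is the affine theory saying the structure is a probability measure algebra and these symbols define an action of $\Gamma$ by automorphisms (each is an embedding, $(\gamma_1\gamma_2)(a)=\gamma_1(\gamma_2(a))$, $1_\Gamma(a)=a$); its models are the measure-preserving systems of $\Gamma$. A system is ergodic if the only $\Gamma$-fixed elements of its measure algebra are $\mathbf0,\mathbf1$. $S^{\mathrm{aff}}_n(T)$ is the compact convex set of affine types of $n$-tuples in models of $T$; a model is extremal if all its finite tuples have extreme types; $T$ is simplicial if every $S^{\mathrm{aff}}_n(T)$ is a Choquet simplex. *)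

(* Defs.v *)
From HB Require Import structures.
From mathcomp Require Import all_boot all_order all_algebra.
From mathcomp Require Import all_classical all_reals all_analysis.

Set Implicit Arguments.
Unset Strict Implicit.
Unset Printing Implicit Defensive.

Import Order.TTheory GRing.Theory Num.Theory.
Import numFieldNormedType.Exports.

Local Open Scope classical_set_scope.
Local Open Scope ring_scope.

(** * Convexity *)

Section convexity.
Context {R : realType}.

Definition extreme_point (V : lmodType R) (X : set V) (p : V) : Prop :=
  X p /\ forall (q r : V) (t : R), X q -> X r -> 0 < t -> t < 1 ->
    p = t *: q + (1 - t) *: r -> q = p /\ r = p.

(* The cone with base [X]; adding a coordinate places [X] in the hyperplane
   at height 1, which misses the origin. *)
Definition base_cone (V : lmodType R) (X : set V) : set (V * R^o) :=
  [set u | exists t x, [/\ 0 <= t, X x & u = (t *: x, t)]].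

(* The span [C - C] of a convex cone [C] is a vector lattice for the order
   [u <= v <-> v - u \in C]. *)
Definition lattice_cone (W : lmodType R) (C : set W) : Prop :=
  let E := [set u - v | u in C & v in C] in
  let le u v := C (v - u) in
  forall u v, E u -> E v ->
    (exists2 w, E w & [/\ le u w, le v w &
       forall z, E z -> le u z -> le v z -> le w z]) /\
    (exists2 w, E w & [/\ le w u, le w v &
       forall z, E z -> le z u -> le z v -> le z w]).

(* Choquet's definition, for subsets of [R^I] with the product topology. *)
Definition choquet_simplex (I : Type) (X : set (I -> R^o)) : Prop :=
  [/\ compact (X : set {ptws I -> R}),
      convex_set (X : set (convex_lmodType (I -> R^o))) &
      lattice_cone (base_cone X)].

End convexity.

(** * Affine logic *)

Section signatures.
Context {R : realType}.

(* Moduli of uniform continuity are Lipschitz constants for the sum metric. *)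
Record signature := Signature {
  fsym : Type;
  farity : fsym -> nat;
  flip : fsym -> R;
  psym : Type;
  parity : psym -> nat;
  plip : psym -> R;
  pbound : psym -> R;
  diam : R }.

Record structure (L : signature) := Structure {
  carrier :> metricType R;
  finterp : forall f : fsym L, ('I_(farity f) -> carrier) -> carrier;
  pinterp : forall P : psym L, ('I_(parity P) -> carrier) -> R;
  carrier_nonempty : [set: carrier] !=set0;
  carrier_complete : forall F : set_system carrier,
    ProperFilter F -> cauchy F -> exists x : carrier, F --> x;
  mdist_le_diam : forall x y : carrier, mdist x y <= diam L;
  finterp_lip : forall f (a b : 'I_(farity f) -> carrier),
    mdist (finterp a) (finterp b) <= flip f * \sum_i mdist (a i) (b i);
  pinterp_lip : forall P (a b : 'I_(parity P) -> carrier),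
    `|pinterp a - pinterp b| <= plip P * \sum_i mdist (a i) (b i);
  pinterp_le : forall P (a : 'I_(parity P) -> carrier),
    `|pinterp a| <= pbound P }.

Inductive term (L : signature) (n : nat) : Type :=
| TVar of 'I_n
| TApp (f : fsym L) of ('I_(farity f) -> term L n).

(* [formula L n]: affine formulas with free variables among [x_0, .., x_(n-1)].
   A quantifier binds [x_0] and shifts the other variables down by one. *)
Inductive formula (L : signature) : nat -> Type :=
| FConst n of R : formula L n
| FDist n of term L n & term L n : formula L n
| FPred n (P : psym L) of ('I_(parity P) -> term L n) : formula L n
| FAdd n of formula L n & formula L n : formula L n
| FScale n of R & formula L n : formula L n
| FSup n of formula L n.+1 : formula L n
| FInf n of formula L n.+1 : formula L n.

Definition theory (L : signature) := set (formula L 0).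

End signatures.

Arguments signature : clear implicits.
Arguments TVar {R L n}.
Arguments TApp {R L n}.
Arguments FConst {R L n}.
Arguments FPred {R L n}.

Section semantics.
Context {R : realType} {L : signature R}.

Definition extend (T : Type) n (x : T) (v : 'I_n -> T) : 'I_n.+1 -> T :=
  fun i => if unlift ord0 i is Some j then v j else x.

Fixpoint teval (M : structure L) n (v : 'I_n -> M) (t : term L n) : M :=
  match t with
  | TVar i => v i
  | TApp f a => finterp (fun i => teval v (a i))
  end.

Fixpoint feval (M : structure L) n (phi : formula L n) : ('I_n -> M) -> R :=
  match phi in formula _ n return ('I_n -> M) -> R with
  | FConst _ r => fun=> r
  | FDist _ s t => fun v => mdist (teval v s) (teval v t)
  | FPred _ P a => fun v => pinterp (fun i => teval v (a i))
  | FAdd _ phi psi => fun v => feval phi v + feval psi v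
  | FScale _ r phi => fun v => r * feval phi v
  | FSup _ phi => fun v => sup (range (fun x => feval phi (extend x v)))
  | FInf _ phi => fun v => inf (range (fun x => feval phi (extend x v)))
  end.

(* A sentence [phi] in a theory stands for the affine condition [phi >= 0]. *)
Definition models (M : structure L) (T : theory L) : Prop :=
  forall phi, T phi -> forall v : 'I_0 -> M, 0 <= feval phi v.

(* An affine type is identified with the functional [phi |-> phi(a)]. *)
Definition aff_type (M : structure L) n (a : 'I_n -> M) : formula L n -> R^o :=
  fun phi => feval phi a.

Definition aff_types (T : theory L) (n : nat) : set (formula L n -> R^o) :=
  [set p | exists M : structure L, models M T /\
             exists a : 'I_n -> M, p = aff_type a].

Arguments aff_types : clear implicits.

Definition extremal (T : theory L) (M : structure L) : Prop :=
  forall n (a : 'I_n -> M), extreme_point (aff_types T n) (aff_type a).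

Definition simplicial (T : theory L) : Prop :=
  forall n, choquet_simplex (aff_types T n).

Definition FSub n (phi psi : formula L n) := FAdd phi (FScale (-1) psi).

Fixpoint inf_closure n : formula L n -> formula L 0 :=
  match n with
  | 0 => id
  | _.+1 => fun phi => inf_closure (FInf phi)
  end.

(* Universal closures of [s = t] and [phi >= psi] as affine conditions. *)
Definition ax_teq n (s t : term L n) : formula L 0 :=
  inf_closure (FScale (-1) (FDist s t)).

Definition ax_ge n (phi psi : formula L n) : formula L 0 :=
  inf_closure (FSub phi psi).

Definition ax_eq n (phi psi : formula L n) : theory L :=
  [set ax_ge phi psi; ax_ge psi phi].

End semantics.

(** * Measure-preserving systems *)

Section pmp.
Context {R : realType} (Gamma : groupType).

Inductive pmp_fsym := Cup | Cap | Neg | Zero | One | Act of Gamma.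

Definition pmp_arity (f : pmp_fsym) : nat :=
  match f with Cup | Cap => 2 | Neg | Act _ => 1 | Zero | One => 0 end.

(* The only predicate symbol is the measure. *)
Definition pmp_sig : signature R :=
  {| fsym := pmp_fsym; farity := pmp_arity; flip := fun=> 1;
     psym := unit; parity := fun=> 1; plip := fun=> 1; pbound := fun=> 1;
     diam := 1 |}.

Section syntax.
Context {n : nat}.
Implicit Types s t : term pmp_sig n.

Definition tcup s t : term pmp_sig n := @TApp _ pmp_sig n Cup (tnth [tuple s; t]).
Definition tcap s t : term pmp_sig n := @TApp _ pmp_sig n Cap (tnth [tuple s; t]).
Definition tneg s : term pmp_sig n := @TApp _ pmp_sig n Neg (tnth [tuple s]).
Definition tzero : term pmp_sig n := @TApp _ pmp_sig n Zero (tnth [tuple]).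
Definition tone : term pmp_sig n := @TApp _ pmp_sig n One (tnth [tuple]).
Definition tact (g : Gamma) s : term pmp_sig n :=
  @TApp _ pmp_sig n (Act g) (tnth [tuple s]).
Definition tsymdiff s t := tcup (tcap s (tneg t)) (tcap t (tneg s)).
Definition fmu s : formula pmp_sig n :=
  @FPred _ pmp_sig n tt (tnth [tuple s]).

End syntax.

Let x : term pmp_sig 3 := TVar (@Ordinal 3 0 isT).
Let y : term pmp_sig 3 := TVar (@Ordinal 3 1 isT).
Let z : term pmp_sig 3 := TVar (@Ordinal 3 2 isT).

Inductive boolean_axioms : theory pmp_sig :=
| cupC : boolean_axioms (ax_teq (tcup x y) (tcup y x))
| capC : boolean_axioms (ax_teq (tcap x y) (tcap y x))
| cupA : boolean_axioms (ax_teq (tcup x (tcup y z)) (tcup (tcup x y) z))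
| capA : boolean_axioms (ax_teq (tcap x (tcap y z)) (tcap (tcap x y) z))
| cupKI : boolean_axioms (ax_teq (tcup x (tcap x y)) x)
| capKU : boolean_axioms (ax_teq (tcap x (tcup x y)) x)
| cupIr : boolean_axioms
    (ax_teq (tcup x (tcap y z)) (tcap (tcup x y) (tcup x z)))
| capUr : boolean_axioms
    (ax_teq (tcap x (tcup y z)) (tcup (tcap x y) (tcap x z)))
| cupN : boolean_axioms (ax_teq (tcup x (tneg x)) tone)
| capN : boolean_axioms (ax_teq (tcap x (tneg x)) tzero).

Definition measure_axioms : theory pmp_sig :=
  ax_eq (fmu (tone : term pmp_sig 0)) (FConst 1)
  `|` ax_eq (FAdd (fmu (tcup x y)) (fmu (tcap x y))) (FAdd (fmu x) (fmu y))
  `|` ax_eq (FDist x y) (fmu (tsymdiff x y)).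

Definition embedding_axioms (g : Gamma) : theory pmp_sig :=
  [set ax_teq (tact g (tcup x y)) (tcup (tact g x) (tact g y));
       ax_teq (tact g (tcap x y)) (tcap (tact g x) (tact g y));
       ax_teq (tact g (tneg x)) (tneg (tact g x));
       ax_teq (tact g tzero) (tzero : term pmp_sig 0);
       ax_teq (tact g tone) (tone : term pmp_sig 0)]
  `|` ax_eq (fmu (tact g x)) (fmu x)
  `|` ax_eq (FDist (tact g x) (tact g y)) (FDist x y).

Definition action_axioms : theory pmp_sig :=
  [set phi | exists g h : Gamma,
     phi = ax_teq (tact (g * h)%g x) (tact g (tact h x))]
  `|` [set ax_teq (tact 1%g x) x].

Definition PMP : theory pmp_sig :=
  boolean_axioms `|` measure_axioms
  `|` \bigcup_g embedding_axioms g `|` action_axioms.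

Definition ergodic (M : structure pmp_sig) : Prop :=
  forall a : M,
    (forall g, @finterp _ _ M (Act g : fsym pmp_sig) (fun=> a) = a) ->
    a = @finterp _ _ M (Zero : fsym pmp_sig) (tnth [tuple]) \/
    a = @finterp _ _ M (One : fsym pmp_sig) (tnth [tuple]).

End pmp.

Arguments PMP : clear implicits.

(* Main.v *)
(** Quantifiers range over a model, so the restriction to an invariant element
    [e] of an affine formula [phi] with parameters in [M] makes sense: cutting
    every atomic formula by [e] gives a functional [rfeval e phi], which is
    [mu e] times the value of [phi] in the system induced on [e], and
    [feval phi = rfeval e phi + rfeval (neg e) phi]. Hence a nontrivial invariant
    element splits types, and extremal models are ergodic.

    Type spaces are compact (ultraproducts) and convex (mixtures of two models),
    and a decomposition of the type of a tuple extends to a decomposition of the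
    type of any longer tuple. If [M] is ergodic and the type of [a] is a
    nontrivial average, the parts agree with it on [mu]: their difference is a
    signed invariant measure, which has an invariant maximizing element. For
    quantified formulas one extends the decomposition to an approximate witness
    in [M].

    For simpliciality, two decompositions of the same type have a common
    refinement: realize one by an invariant element, extend the other to a type
    mentioning this element, and cut. The refinement property and compactness
    make the cone over the type space a lattice. *)

From HB Require Import structures.
From mathcomp Require Import all_boot all_order all_algebra.
From mathcomp Require Import all_classical all_reals all_analysis.
From mathcomp Require Import ring lra.
Require Import Defs.

Set Implicit Arguments.
Unset Strict Implicit.
Unset Printing Implicit Defensive.

Import Order.TTheory GRing.Theory Num.Theory.
Import numFieldNormedType.Exports.

Local Open Scope classical_set_scope.
Local Open Scope ring_scope.

(** * Metric structures from pseudometric data *)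

(** Ultraproducts and mixtures are one construction: a product of structures averaged by a finitely
    additive mean. Affine formulas commute with every such mean, linear combinations by linearity
    and suprema by choosing near-optimal elements in all coordinates at once.

    Extending a decomposition to a longer tuple is a separation statement. Affine constraints on a
    compact convex set of pairs of types have a common solution unless a linear combination of them
    is bounded away from zero. Such a combination amounts to a single affine formula, whose supremum
    over the new variable is already controlled by the decomposition of the shorter tuple.

    The signed measure obtained from a decomposition is given only on terms in the tuple, whereas
    ergodicity speaks of elements of [M]. It is therefore replaced by a Lipschitz supermodular
    function on all of [M], and completeness of [M] provides the invariant maximizer.

    A relativized value is itself the value of a formula in which the invariant element is one of
    the variables. This is what carries it from one model to another through types. *)

Section geo_complete.
Context {R : realType}.

(** Completeness stated through [d] alone, without a topology or separation, so that it can be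
    checked on pseudometrics and coordinate by coordinate in products. *)
Definition geo_complete (T : Type) (d : T -> T -> R) :=
  forall (u : nat -> T) (C : R),
    (forall k, d (u k) (u k.+1) <= C * 2^-1 ^+ k) ->
  exists x (B : R), forall k, d (u k) x <= B * 2^-1 ^+ k.

Lemma geo_small (C e : R) : 0 < e -> exists k, C * 2^-1 ^+ k < e.
Proof.
move=> e0; have h : `|2^-1 : R| < 1 by rewrite ger0_norm ?invr_ge0// invf_lt1 ?ltr1n.
have /cvgrPdist_lt/(_ _ e0)[k _ /(_ k (leqnn _))] : (fun k => C * 2^-1 ^+ k) @ \oo --> (0 : R).
  by rewrite -[X in _ --> X](mulr0 C); apply: cvgMr; exact: cvg_expr.
by rewrite /= sub0r normrN => hk; exists k; rewrite (le_lt_trans (ler_norm _)).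
Qed.

Lemma geo_dist (T : Type) (d : T -> T -> R) (u : nat -> T) (C : R) :
  (forall x, d x x = 0) -> (forall y x z, d x z <= d x y + d y z) -> 0 <= C ->
  (forall k, d (u k) (u k.+1) <= C * 2^-1 ^+ k) ->
  forall k m, d (u k) (u (k + m)%N) <= 2 * C * 2^-1 ^+ k.
Proof.
move=> dxx dtri C0 h k m.
have p0 j : 0 <= 2^-1 ^+ j :> R by rewrite exprn_ge0// invr_ge0.
(* Subtracting the remaining tail of the geometric series gives a bound that survives induction on
   [m]. *)
suff : d (u k) (u (k + m)%N) <= 2 * C * 2^-1 ^+ k - 2 * C * 2^-1 ^+ (k + m)%N.
  by move/le_trans; apply; rewrite gerBl !mulr_ge0.
elim: m => [|m IH]; first by rewrite addn0 dxx subrr.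
rewrite addnS; apply: (le_trans (dtri (u (k + m)%N) _ _)).
apply: (le_trans (lerD IH (h _))).
rewrite exprS; move: (2^-1 ^+ (k + m)) (2^-1 ^+ k) => a b; lra.
Qed.

Lemma complete_geo (T : metricType R) :
  (forall F : set_system T, ProperFilter F -> cauchy F -> exists x : T, F --> x) ->
  geo_complete (@mdist R T).
Proof.
move=> cT u C hu.
have C0 : 0 <= C by have := le_trans (mdist_ge0 _ _) (hu 0%N); rewrite mulr1.
have hd := geo_dist (@mdistxx _ _) (fun y x z => metric_triangle x y z) C0 hu.
have [x ux] : exists x : T, u @ \oo --> x.
  apply: cT; apply: cauchy_exP => e e0.
  have [k hk] := geo_small (2 * C) e0.
  exists (u k), k => // m /= km.
  by rewrite ballEmdist /= -(subnKC km) (le_lt_trans (hd _ _)).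
exists x, (2 * C) => k; apply/ler_addgt0Pl => e e0.
have [m _ hm] : \forall m \near \oo, ball x e (u m) by apply: ux; apply: nbhsx_ballx.
have := hm (k + m)%N (leq_addl _ _); rewrite ballEmdist /= => hx.
rewrite (le_trans (metric_triangle _ (u (k + m)%N) _))// addrC lerD//.
by rewrite metric_sym ltW.
Qed.

(** A Cauchy filter contains a ball of radius [2^-k] for each [k]. Any two of these balls meet, so
    their centres form a fast Cauchy sequence, and its limit is the limit of the filter. *)
Lemma geo_complete_cvg (T : metricType R) : geo_complete (@mdist R T) ->
  forall F : set_system T, ProperFilter F -> cauchy F -> exists x : T, F --> x.
Proof.
move=> cT F FF /(iffLR (cauchyP F)) cF.
have p0 j : 0 < 2^-1 ^+ j :> R by rewrite exprn_gt0// invr_gt0.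
have [u hu] := choice (fun k => cF _ (p0 k)).
have hd k : mdist (u k) (u k.+1) <= 2 * 2^-1 ^+ k.
  have [z []] := filter_ex (filterI (hu k) (hu k.+1)).
  rewrite !ballEmdist /= exprS => h1 h2.
  rewrite (le_trans (metric_triangle _ z _))// (metric_sym z).
  by move: h1 h2 (p0 k); move: (2^-1 ^+ k) => a; lra.
have [x [B hB]] := cT _ _ hd; exists x.
apply/cvg_ballP => e e0.
have [k hk] := geo_small (B + 1) e0.
near=> z; rewrite ballEmdist /= (le_lt_trans _ hk)//.
rewrite (le_trans (metric_triangle _ (u k) _))// mulrDl mul1r lerD//.
  by rewrite metric_sym.
by near: z; apply: filterS (hu k) => z; rewrite ballEmdist /= => /ltW.
Unshelve. all: by end_near. Qed.

End geo_complete.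

Section metric_quotient.
Context {R : realType} (T : Type) (d : T -> T -> R).
Hypotheses (dxx : forall x, d x x = 0) (dC : forall x y, d x y = d y x).
Hypothesis dtri : forall y x z, d x z <= d x y + d y z.

(* The class of [x] at distance zero is represented by [d x]. *)
Definition mquot := {f : T -> R | exists x, f = d x}.
Definition mpi (x : T) : mquot := exist _ (d x) (ex_intro _ x erefl).
Definition mrepr (q : mquot) : T := sval (cid (svalP q)).

Lemma mquot_inj (p q : mquot) : sval p = sval q -> p = q.
Proof. by case: p q => f hf [g hg] /=; exact: eq_exist. Qed.

Lemma mreprK q : mpi (mrepr q) = q.
Proof. exact/mquot_inj/esym/(svalP (cid (svalP q))). Qed.

Lemma mpi_eq x y : d x y = 0 -> mpi x = mpi y.
Proof.
move=> xy; apply: mquot_inj; apply/funext => z; apply: le_anti.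
by rewrite (le_trans (dtri y _ _)) ?xy ?add0r//= (le_trans (dtri x _ _)) // dC xy add0r.
Qed.

Lemma mrepr_pi x z : d (mrepr (mpi x)) z = d x z.
Proof. by rewrite -[LHS]/(sval (mpi (mrepr (mpi x))) z) mreprK. Qed.

HB.instance Definition _ := gen_eqMixin mquot.
HB.instance Definition _ := gen_choiceMixin mquot.

Definition mquot_dist (p q : mquot) := d (mrepr p) (mrepr q).

Let qxx p : mquot_dist p p = 0. Proof. exact: dxx. Qed.
Let qpos p q : mquot_dist p q = 0 -> p = q.
Proof. by move/mpi_eq; rewrite !mreprK. Qed.
Let qC p q : mquot_dist p q = mquot_dist q p. Proof. exact: dC. Qed.
Let qtri q p r : mquot_dist p r <= mquot_dist p q + mquot_dist q r.
Proof. exact: dtri. Qed.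

Definition mquot_metric : metricType R :=
  HB.pack mquot (isMetric.Build R mquot qxx qpos qC qtri).

Lemma mdist_mpi x y : mdist (mpi x : mquot_metric) (mpi y : mquot_metric) = d x y.
Proof. by rewrite /mdist/= /mquot_dist mrepr_pi dC mrepr_pi dC. Qed.

Lemma mquot_complete : geo_complete d -> geo_complete (@mdist R mquot_metric).
Proof.
move=> cd u C hu.
have [x [B hx]] := cd (fun k => mrepr (u k)) C hu.
exists (mpi x : mquot_metric), B => k.
by rewrite -[u k]mreprK mdist_mpi; exact: hx.
Qed.

End metric_quotient.

(** * Structures on pseudometric spaces and their metric quotients *)

Section prestructure.
Context {R : realType} (L : signature R).

(** The data of a structure before points at distance zero are identified. The Lipschitz conditions
    make all symbols descend to the quotient, which is the common last step of ultraproducts,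
    mixtures and cuts. *)
Record prestructure := Prestructure {
  pcarrier :> Type;
  pdist : pcarrier -> pcarrier -> R;
  pfun : forall f : fsym L, ('I_(farity f) -> pcarrier) -> pcarrier;
  ppred : forall P : psym L, ('I_(parity P) -> pcarrier) -> R;
  pcarrier_nonempty : [set: pcarrier] !=set0;
  pdistxx : forall x, pdist x x = 0;
  pdistC : forall x y, pdist x y = pdist y x;
  pdist_triangle : forall y x z, pdist x z <= pdist x y + pdist y z;
  pcarrier_complete : geo_complete pdist;
  pdist_le_diam : forall x y, pdist x y <= diam L;
  pfun_lip : forall f (a b : 'I_(farity f) -> pcarrier),
    pdist (pfun a) (pfun b) <= flip f * \sum_i pdist (a i) (b i);
  ppred_lip : forall P (a b : 'I_(parity P) -> pcarrier),
    `|ppred a - ppred b| <= plip P * \sum_i pdist (a i) (b i);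
  ppred_le : forall P (a : 'I_(parity P) -> pcarrier), `|ppred a| <= pbound P }.

Variable X : prestructure.
Let Q := mquot_metric (@pdistxx X) (@pdistC X) (@pdist_triangle X).
Let pi (x : X) : Q := mpi (@pdist X) x.
Let rp (q : Q) : X := mrepr q.

Let rpK q : pi (rp q) = q. Proof. exact: mreprK. Qed.
Let dpi x y : mdist (pi x) (pi y) = pdist x y. Proof. exact: mdist_mpi. Qed.
Let drp p q : pdist (rp p) (rp q) = mdist p q. Proof. by rewrite -dpi !rpK. Qed.

Let qfun (f : fsym L) (a : 'I_(farity f) -> Q) : Q := pi (pfun (rp \o a)).
Let qpred (P : psym L) (a : 'I_(parity P) -> Q) : R := ppred (rp \o a).

Let q0 : [set: Q] !=set0. Proof. by have [x _] := pcarrier_nonempty X; exists (pi x). Qed.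
Let qcomplete : forall F : set_system Q,
  ProperFilter F -> cauchy F -> exists x : Q, F --> x.
Proof. exact/geo_complete_cvg/mquot_complete/pcarrier_complete. Qed.
Let qdiam (x y : Q) : mdist x y <= diam L.
Proof. by rewrite -drp pdist_le_diam. Qed.
Let qfun_lip f (a b : 'I_(farity f) -> Q) :
  mdist (qfun a) (qfun b) <= flip f * \sum_i mdist (a i) (b i).
Proof. by rewrite dpi (le_trans (pfun_lip _ _))//= (eq_bigr _ (fun i _ => drp _ _)). Qed.
Let qpred_lip P (a b : 'I_(parity P) -> Q) :
  `|qpred a - qpred b| <= plip P * \sum_i mdist (a i) (b i).
Proof. by rewrite (le_trans (ppred_lip _ _))//= (eq_bigr _ (fun i _ => drp _ _)). Qed.
Let qpred_le P (a : 'I_(parity P) -> Q) : `|qpred a| <= pbound P.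
Proof. exact: ppred_le. Qed.

Definition quotient : structure L :=
  Structure q0 qcomplete qdiam qfun_lip qpred_lip qpred_le.

Definition qpi (x : X) : quotient := pi x.
Definition qrepr (q : quotient) : X := rp q.

Lemma qreprK q : qpi (qrepr q) = q. Proof. exact: rpK. Qed.

Lemma mdist_qpi x y : mdist (qpi x) (qpi y) = pdist x y. Proof. exact: dpi. Qed.

Let pd0 x : pdist (rp (pi x)) x = 0. Proof. by rewrite -dpi rpK mdistxx. Qed.

Lemma finterp_qpi f (a : 'I_(farity f) -> X) :
  finterp (fun i => qpi (a i)) = qpi (pfun a).
Proof.
apply: mdist_positivity; apply: le_anti; rewrite mdist_ge0 andbT mdist_qpi.
rewrite (le_trans (pfun_lip _ _))//= [X in _ * X]big1 ?mulr0//.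
Qed.

Lemma pinterp_qpi P (a : 'I_(parity P) -> X) :
  pinterp (fun i => qpi (a i)) = ppred a.
Proof.
apply/eqP; rewrite -subr_eq0 -normr_eq0 eq_le normr_ge0 andbT.
rewrite (le_trans (ppred_lip _ _))//= [X in _ * X]big1 ?mulr0//.
Qed.

Fixpoint pteval n (v : 'I_n -> X) (t : term L n) : X :=
  match t with TVar i => v i | TApp f a => pfun (fun i => pteval v (a i)) end.

Lemma teval_qpi n (v : 'I_n -> X) t : teval (qpi \o v) t = qpi (pteval v t).
Proof.
elim: t => [//|f a IH] /=; rewrite -finterp_qpi.
by have -> : (fun i => teval (qpi \o v) (a i)) = fun i => qpi (pteval v (a i)) by exact/funext.
Qed.

Lemma range_quotient (T : Type) (g : quotient -> T) : range g = range (g \o qpi).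
Proof.
apply/seteqP; split => _ [q _ <-]; last by exists (qpi q).
by exists (qrepr q) => //=; rewrite qreprK.
Qed.

End prestructure.

Arguments quotient {R L} X : simpl never.

(** * Means and the theorem of Łoś for affine formulas *)

Section range_bounds.
Context {R : realType} (T : Type) (g : T -> R) (B : R).
Hypotheses (T0 : [set: T] !=set0) (gB : forall x, `|g x| <= B).

Let g0 : range g !=set0. Proof. by have [x _] := T0; exists (g x), x. Qed.
Let gu : has_ubound (range g).
Proof. by exists B => _ [x _ <-]; rewrite (le_trans (ler_norm _)). Qed.
Let gl : has_lbound (range g).
Proof. by exists (- B) => _ [x _ <-]; rewrite lerNl (le_trans (ler_norm _))// normrN. Qed.

Lemma le_sup_range x : g x <= sup (range g).
Proof. by apply: ub_le_sup => //; exists x. Qed.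
Lemma sup_range_le c : (forall x, g x <= c) -> sup (range g) <= c.
Proof. by move=> h; apply: ge_sup => // _ [x _ <-]. Qed.
Lemma sup_range_near e : 0 < e -> exists x, sup (range g) - e < g x.
Proof. by move=> e0; have [_ [x _ <-] hx] := sup_adherent e0 (conj g0 gu); exists x. Qed.
Lemma inf_range_le x : inf (range g) <= g x.
Proof. by apply: ge_inf => //; exists x. Qed.
Lemma le_inf_range c : (forall x, c <= g x) -> c <= inf (range g).
Proof. by move=> h; apply: lb_le_inf => // _ [x _ <-]. Qed.
Lemma inf_range_near e : 0 < e -> exists x, g x < inf (range g) + e.
Proof. by move=> e0; have [_ [x _ <-] hx] := inf_adherent e0 (conj g0 gl); exists x. Qed.
Lemma sup_range_norm : `|sup (range g)| <= B.
Proof.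
have [x _] := T0; rewrite ler_norml sup_range_le ?andbT; last first.
  by move=> y; rewrite (le_trans (ler_norm _)).
by apply: le_trans (le_sup_range x); rewrite lerNl (le_trans (ler_norm _))// normrN.
Qed.
Lemma inf_range_norm : `|inf (range g)| <= B.
Proof.
have [x _] := T0; rewrite ler_norml le_inf_range //=; last first.
  by move=> y; rewrite lerNl (le_trans (ler_norm _))// normrN.
by apply: le_trans (inf_range_le x) _; rewrite (le_trans (ler_norm _)).
Qed.

End range_bounds.

Section formula_bound.
Context {R : realType} {L : signature R}.

(* Unlike [/=], rewriting with these leaves carriers folded. *)
Lemma fevalE (M : structure L) n (v : 'I_n -> M) :
  (forall r, feval (FConst r) v = r) *
  (forall s t, feval (FDist s t) v = mdist (teval v s) (teval v t)) *
  (forall P a, feval (FPred P a) v = pinterp (fun i => teval v (a i))) *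
  (forall p q, feval (FAdd p q) v = feval p v + feval q v) *
  (forall r p, feval (FScale r p) v = r * feval p v) *
  (forall p, feval (FSup p) v = sup (range (fun x => feval p (extend x v)))) *
  (forall p, feval (FInf p) v = inf (range (fun x => feval p (extend x v)))).
Proof. by []. Qed.

Fixpoint fbound n (phi : formula L n) : R :=
  match phi with
  | FConst _ r => `|r|
  | FDist _ _ _ => diam L
  | FPred _ P _ => pbound P
  | FAdd _ phi psi => fbound phi + fbound psi
  | FScale _ r phi => `|r| * fbound phi
  | FSup _ phi => fbound phi
  | FInf _ phi => fbound phi
  end.

Lemma feval_bound (M : structure L) n (phi : formula L n) (v : 'I_n -> M) :
  `|feval phi v| <= fbound phi.
Proof.
elim: phi v => [//|{}n s t v|{}n P a v|{}n p IHp q IHq v|{}n r p IH v|{}n p IH v|{}n p IH v] /=.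
- by rewrite ger0_norm ?mdist_ge0 ?mdist_le_diam.
- exact: pinterp_le.
- by rewrite (le_trans (ler_normD _ _))// lerD.
- by rewrite normrM ler_wpM2l.
- by apply: sup_range_norm => //; exact: carrier_nonempty.
- by apply: inf_range_norm => //; exact: carrier_nonempty.
Qed.

End formula_bound.

(** * Finitely additive means *)

Section mean.
Context {R : realType} (I : Type).

Definition bdd (f : I -> R) := exists B, forall i, `|f i| <= B.

Lemma bdd_cst c : bdd (fun=> c). Proof. by exists `|c|. Qed.
Lemma bddD f g : bdd f -> bdd g -> bdd (fun i => f i + g i).
Proof. by move=> [B h] [C k]; exists (B + C) => i; rewrite (le_trans (ler_normD _ _))// lerD. Qed.
Lemma bddZ r f : bdd f -> bdd (fun i => r * f i).
Proof. by move=> [B h]; exists (`|r| * B) => i; rewrite normrM ler_wpM2l. Qed.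
Lemma bdd_sum k (f : 'I_k -> I -> R) :
  (forall j, bdd (f j)) -> bdd (fun i => \sum_j f j i).
Proof.
move=> h; have [B hB] := choice h.
by exists (\sum_j B j) => i; rewrite (le_trans (ler_norm_sum _ _ _))// ler_sum.
Qed.

(** A positive normalized linear functional on bounded functions. The two instances are the limit
    along an ultrafilter and the average with weights [t] and [1 - t] on two points. *)
Record mean := Mean {
  mean_fun :> (I -> R) -> R;
  meanD : forall f g, bdd f -> bdd g ->
    mean_fun (fun i => f i + g i) = mean_fun f + mean_fun g;
  meanZ : forall r f, bdd f -> mean_fun (fun i => r * f i) = r * mean_fun f;
  mean_le : forall f g, bdd f -> bdd g -> (forall i, f i <= g i) -> mean_fun f <= mean_fun g;
  mean_cst : forall c, mean_fun (fun=> c) = c }.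

Variable m : mean.

Lemma mean_sum k (f : 'I_k -> I -> R) :
  (forall j, bdd (f j)) -> m (fun i => \sum_j f j i) = \sum_j m (f j).
Proof.
elim: k f => [|k IH] f h.
  by rewrite big_ord0 -[RHS](mean_cst m); congr (m _); apply/funext => i; rewrite big_ord0.
rewrite big_ord_recl -IH// -meanD//; last exact: bdd_sum.
by congr (m _); apply/funext => i; rewrite big_ord_recl.
Qed.

Lemma meanB_le f g h : bdd f -> bdd g -> bdd h ->
  (forall i, `|f i - g i| <= h i) -> `|m f - m g| <= m h.
Proof.
move=> bf bg bh hh; rewrite ler_distl lerBlDr -!meanD//.
by apply/andP; split; apply: mean_le => //; try exact: bddD; move=> i;
  have := hh i; rewrite ler_distl => /andP[]; lra.
Qed.

Lemma mean_norm_le f c : bdd f -> (forall i, `|f i| <= c) -> `|m f| <= c.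
Proof.
move=> bf h; rewrite -[m f]subr0 -(mean_cst m 0) -[leRHS](mean_cst m c).
by apply: meanB_le => //; try exact: bdd_cst; move=> i; rewrite subr0.
Qed.

(** An element of the product is chosen freely in each coordinate, so one choice is within [e] of
    the supremum in every coordinate simultaneously. This is the quantifier case of [los]. *)
Lemma mean_sup (T : I -> Type) (g : forall i, T i -> R) (B : R) :
  (forall i, [set: T i] !=set0) -> (forall i x, `|g i x| <= B) ->
  m (fun i => sup (range (g i))) = sup (range (fun x : forall i, T i => m (fun i => g i (x i)))).
Proof.
move=> T0 gB.
have P0 : [set: forall i, T i] !=set0.
  by exists (fun i => sval (cid (T0 i))).
have b1 (x : forall i, T i) : bdd (fun i => g i (x i)) by exists B => i.
have mB x : `|m (fun i => g i (x i))| <= B by apply: mean_norm_le.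
have bS : bdd (fun i => sup (range (g i))) by exists B => i; exact: sup_range_norm.
apply: le_anti; apply/andP; split; last first.
  apply: sup_range_le => // x; apply: mean_le => // i.
  exact: (le_sup_range (gB i)).
apply/ler_addgt0Pl => e e0.
have [x hx] : {x : forall i, T i | forall i, sup (range (g i)) - e < g i (x i)}.
  exists (fun i => sval (cid (sup_range_near (T0 i) (gB i) e0))) => i.
  exact: (svalP (cid (sup_range_near (T0 i) (gB i) e0))).
apply: (@le_trans _ _ (e + m (fun i => g i (x i)))); last first.
  by rewrite lerD2l; exact: (le_sup_range mB).
rewrite -{1}(mean_cst m e) -meanD//; last exact: bdd_cst.
apply: mean_le => //; first by apply: bddD => //; exact: bdd_cst.
by move=> i; have := hx i; lra.
Qed.

Lemma meanN f : bdd f -> m (fun i => - f i) = - m f.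
Proof.
move=> bf; rewrite -[RHS]mulN1r -meanZ//; congr (m _); apply/funext => i.
by rewrite mulN1r.
Qed.

Lemma inf_rangeN (T : Type) (g : T -> R) : inf (range g) = - sup (range (fun x => - g x)).
Proof. by rewrite /inf; congr (- sup _); rewrite image_comp. Qed.

Lemma mean_inf (T : I -> Type) (g : forall i, T i -> R) (B : R) :
  (forall i, [set: T i] !=set0) -> (forall i x, `|g i x| <= B) ->
  m (fun i => inf (range (g i))) = inf (range (fun x : forall i, T i => m (fun i => g i (x i)))).
Proof.
move=> T0 gB.
have -> : (fun i => inf (range (g i))) = (fun i => - sup (range (fun x => - g i x))).
  by apply/funext => i; rewrite inf_rangeN.
rewrite meanN; last first.
  by exists B => i; apply: sup_range_norm => // x; rewrite normrN.
rewrite (@mean_sup _ (fun i x => - g i x) B)//; last by move=> i x; rewrite normrN.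
have -> // : (fun x : forall i, T i => m (fun i => - g i (x i))) =
    (fun x => - m (fun i => g i (x i))).
  by apply/funext => x; rewrite meanN//; exists B => i.
by rewrite inf_rangeN.
Qed.

End mean.

Section ultramean.
Context {R : realType} {L : signature R} (I : Type) (m : @mean R I) (M : I -> structure L).

Definition umean_dist (x y : forall i, M i) : R := m (fun i => mdist (x i) (y i)).

(** Completeness of the averaged product is the only point at which the two kinds of mean call for
    different arguments. *)
Hypothesis cM : geo_complete umean_dist.

Lemma bdd_mdist (x y : forall i, M i) : bdd (fun i => mdist (x i) (y i)).
Proof. by exists (diam L) => i; rewrite ger0_norm ?mdist_ge0 ?mdist_le_diam. Qed.

Let X := forall i, M i.
Let ufun (f : fsym L) (a : 'I_(farity f) -> X) : X :=
  fun i => finterp (fun j => a j i).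
Let upred (P : psym L) (a : 'I_(parity P) -> X) : R :=
  m (fun i => pinterp (fun j => a j i)).

Let u0 : [set: X] !=set0.
Proof. by exists (fun i => sval (cid (carrier_nonempty (M i)))). Qed.
Let uxx x : umean_dist x x = 0.
Proof.
by rewrite -[RHS](mean_cst m); congr (m _); apply/funext => i; rewrite mdistxx.
Qed.
Let uC x y : umean_dist x y = umean_dist y x.
Proof. by congr (m _); apply/funext => i; rewrite metric_sym. Qed.
Let utri y x z : umean_dist x z <= umean_dist x y + umean_dist y z.
Proof.
rewrite -meanD; try exact: bdd_mdist.
apply: mean_le; [exact: bdd_mdist|by apply: bddD; exact: bdd_mdist|].
by move=> i; exact: metric_triangle.
Qed.
Let udiam x y : umean_dist x y <= diam L.
Proof.
rewrite -[leRHS](mean_cst m); apply: mean_le; [exact: bdd_mdist|exact: bdd_cst|].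
by move=> i; exact: mdist_le_diam.
Qed.
Let bdd_distsum k (a b : 'I_k -> X) : bdd (fun i => \sum_j mdist (a j i) (b j i)).
Proof. by apply: bdd_sum => j; exact: bdd_mdist. Qed.
Let umean_sum c k (a b : 'I_k -> X) :
  c * \sum_j umean_dist (a j) (b j) = m (fun i => c * \sum_j mdist (a j i) (b j i)).
Proof. by rewrite meanZ// mean_sum// => j; exact: bdd_mdist. Qed.
Let ufun_lip f (a b : 'I_(farity f) -> X) :
  umean_dist (ufun a) (ufun b) <= flip f * \sum_i umean_dist (a i) (b i).
Proof.
rewrite umean_sum; apply: mean_le; [exact: bdd_mdist|exact: bddZ|].
by move=> i; exact: finterp_lip.
Qed.
Let bdd_pinterp P (a : 'I_(parity P) -> X) : bdd (fun i => pinterp (fun j => a j i)).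
Proof. by exists (pbound P) => i; exact: pinterp_le. Qed.
Let upred_lip P (a b : 'I_(parity P) -> X) :
  `|upred a - upred b| <= plip P * \sum_i umean_dist (a i) (b i).
Proof.
rewrite umean_sum; apply: meanB_le => //; first exact: bddZ.
by move=> i; exact: pinterp_lip.
Qed.
Let upred_le P (a : 'I_(parity P) -> X) : `|upred a| <= pbound P.
Proof. by apply: mean_norm_le => // i; exact: pinterp_le. Qed.

Definition umean_pre : prestructure L :=
  Prestructure u0 uxx uC utri cM udiam ufun_lip upred_lip upred_le.

Definition umean : structure L := quotient umean_pre.

Lemma pteval_umean n (v : 'I_n -> umean_pre) (t : term L n) :
  pteval v t = fun i => teval (fun j => v j i) t.
Proof.
elim: t => [//|f a IH] /=; apply: functional_extensionality_dep => i; rewrite /ufun /=.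
by have -> : (fun j => pteval v (a j) i) = fun j => teval (fun k => v k i) (a j)
  by apply/funext => j; rewrite IH.
Qed.

Lemma extend_comp (A B : Type) (h : A -> B) n (x : A) (v : 'I_n -> A) :
  extend (h x) (h \o v) = h \o extend x v.
Proof. by apply/funext => i; rewrite /extend /=; case: unlift. Qed.

(** Affine connectives pass through a mean by linearity and quantifiers by [mean_sup] and
    [mean_inf]. The value of a formula is thus averaged, rather than decided by a large set of
    indices. *)
Lemma los n (phi : formula L n) (v : 'I_n -> umean_pre) :
  feval phi (@qpi _ _ umean_pre \o v) = m (fun i => feval phi (fun j => v j i)).
Proof.
have bf k (q : formula L k) (w : 'I_k -> X) : bdd (fun i => feval q (fun j => w j i)).
  by exists (fbound q) => i; exact: feval_bound.
have ext k (x : X) (w : 'I_k -> X) i :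
    (fun j => extend x w j i) = extend (x i) (fun j => w j i).
  by apply/funext => j; rewrite /extend; case: unlift.
elim: phi v => [{}n r v|{}n s t v|{}n P a v|{}n p IHp q IHq v|{}n r p IH v|{}n p IH v|{}n p IH v]; rewrite fevalE.
- by rewrite mean_cst.
- by rewrite !teval_qpi mdist_qpi !pteval_umean.
- have -> : (fun i => teval (@qpi _ _ umean_pre \o v) (a i)) =
      fun i => qpi (pteval v (a i)) by apply/funext => i; rewrite teval_qpi.
  rewrite pinterp_qpi /= /upred; congr (m _); apply/funext => i; congr (pinterp _).
  by apply/funext => j; rewrite pteval_umean.
- by rewrite IHp IHq meanD.
- by rewrite IH meanZ.
- rewrite range_quotient (@mean_sup _ _ _ _ _ (fbound p)).
  + congr (sup _); apply: eq_imagel => x _ /=.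
    rewrite extend_comp IH; congr (m _); apply/funext => i.
    by rewrite ext.
  + by move=> i; exact: carrier_nonempty.
  + by move=> i x; exact: feval_bound.
- rewrite range_quotient (@mean_inf _ _ _ _ _ (fbound p)).
  + congr (inf _); apply: eq_imagel => x _ /=.
    rewrite extend_comp IH; congr (m _); apply/funext => i.
    by rewrite ext.
  + by move=> i; exact: carrier_nonempty.
  + by move=> i x; exact: feval_bound.
Qed.

Lemma models_umean (T : theory L) : (forall i, models (M i) T) -> models umean T.
Proof.
move=> MT phi Tphi v.
have -> : v = @qpi _ _ umean_pre \o (fun i : 'I_0 => qrepr (v i)).
  by apply/funext => i; rewrite /= qreprK.
rewrite los -(mean_cst m 0); apply: mean_le; [exact: bdd_cst| |].
  by exists (fbound phi) => i; exact: feval_bound.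
by move=> i; exact: MT.
Qed.

End ultramean.

(** * Compactness and convexity of the type spaces *)

Section pointwise_topology.
Context {U : Type} {V : topologicalType}.

Lemma ptws_cvg (F : set_system {ptws U -> V}) (f : {ptws U -> V}) :
  Filter F -> (forall t, (fun g => g t) @ F --> f t) -> F --> f.
Proof.
move=> FF h; apply/cvg_sup => t A; rewrite nbhsE => -[B [[W oW <-] Wf] BA].
by apply: filterS BA _; apply: (h t); exact: open_nbhs_nbhs.
Qed.

Lemma ptws_eval_continuous (t : U) : continuous (fun g : {ptws U -> V} => g t).
Proof.
move=> f A nA; have /cvg_sup/(_ t) : nbhs f --> f by exact: cvg_id.
apply; exact: (@initial_continuous {ptws U -> V} V (fun g => g t) f A nA).
Qed.

End pointwise_topology.

Section ultrafilter_mean.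
Context {R : realType} (I : Type) (F : set_system I) (UF : UltraFilter F).

Lemma ultra_cvg (f : I -> R) : bdd f -> cvg (f @ F).
Proof.
move=> [B hB]; have FB : (f @ F) `[- B, B]%classic.
  by apply: (@filterS _ F _ setT); [move=> i _ /=; rewrite in_itv/= -ler_norml|exact: filterT].
have [p [_ hp]] := segment_compact _ FB.
apply/cvg_ex; exists p => A pA.
have [//|FnA] := in_ultra_setVsetC (f @^-1` A) UF.
by have [x []] := hp (~` A) A FnA pA.
Qed.

Lemma ultra_cvg_le (f g : I -> R) (a b : R) : f @ F --> a -> g @ F --> b ->
  (\forall i \near F, f i <= g i) -> a <= b.
Proof.
move=> fa gb fg; rewrite -subr_ge0.
apply: (@closed_cvg _ _ F _ (fun i => g i - f i) [set x | 0 <= x]).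
- exact: closed_ge.
- by apply: filterS fg => i; rewrite /= subr_ge0.
- exact: cvgB.
Qed.

Lemma ultra_limD f g : bdd f -> bdd g ->
  lim ((fun i => f i + g i) @ F) = lim (f @ F) + lim (g @ F) :> R.
Proof. by move=> bf bg; apply/cvg_lim => //; apply: cvgD; exact: ultra_cvg. Qed.

Lemma ultra_limZ r f : bdd f -> lim ((fun i => r * f i) @ F) = r * lim (f @ F) :> R.
Proof. by move=> bf; apply/cvg_lim => //; apply: cvgMl_tmp; exact: ultra_cvg. Qed.

Lemma ultra_lim_le f g : bdd f -> bdd g -> (forall i, f i <= g i) ->
  lim (f @ F) <= lim (g @ F) :> R.
Proof.
move=> bf bg h; apply: (ultra_cvg_le (ultra_cvg bf) (ultra_cvg bg)).
by apply: (@filterS _ F _ setT) => [i _|]; [exact: h|exact: filterT].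
Qed.

Lemma ultra_lim_cst (c : R) : lim ((fun=> c) @ F) = c.
Proof. by apply/cvg_lim => //; exact: cvg_cst. Qed.

Definition ultra_mean : @mean R I := Mean ultra_limD ultra_limZ ultra_lim_le ultra_lim_cst.

Lemma ultra_mean_le (f : I -> R) c : bdd f -> (\forall i \near F, f i <= c) -> ultra_mean f <= c.
Proof.
by move=> bf; exact: (ultra_cvg_le (ultra_cvg bf) (cvg_cst c)).
Qed.

Lemma ultra_mean_lt (f : I -> R) c : bdd f -> ultra_mean f < c -> \forall i \near F, f i < c.
Proof.
move=> bf h; have [//|hn] := in_ultra_setVsetC [set i | f i < c] UF.
move: h; rewrite ltNge => /negP[].
apply: (ultra_cvg_le (cvg_cst c) (ultra_cvg bf)).
by apply: filterS hn => i /=; rewrite leNgt => /negP.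
Qed.

Context {L : signature R} (M : I -> structure L).

(** Each step of [u] is small for [F]-many indices, but perhaps no index satisfies all these bounds.
    The sequence is replaced by one that is fast Cauchy in every coordinate and, at each stage,
    agrees with [u] for [F]-many indices. *)
Lemma ultra_complete : geo_complete (umean_dist ultra_mean (M := M)).
Proof.
move=> u C hu.
have b (x y : forall i, M i) : bdd (fun i => mdist (x i) (y i)) by exact: bdd_mdist.
have p0 j : 0 < 2^-1 ^+ j :> R by rewrite exprn_gt0// invr_gt0.
(* Raising [C] to [C + 1] makes the inequality strict, so that a bound on the mean becomes a bound
   on a set of [F]. *)
pose close i k := mdist (u k i) (u k.+1 i) < (C + 1) * 2^-1 ^+ k.
have nclose k : F (close ^~ k).
  apply: ultra_mean_lt => //; apply: le_lt_trans (hu k) _.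
  by rewrite mulrDl mul1r ltrDl.
pose good i k := forall j, (j < k)%N -> close i j.
have ngood k : F (good ^~ k).
  elim: k => [|k IH]; first by apply: (@filterS _ F _ setT) => [i _ j|] //; exact: filterT.
  apply: filterS (filterI IH (nclose k)) => i [gk ck] j.
  by rewrite ltnS leq_eqVlt => /orP[/eqP ->//|]; exact: gk.
have C0 : 0 <= C by have := hu 0%N; rewrite mulr1; apply: le_trans;
  rewrite -(mean_cst ultra_mean 0); apply: mean_le => //; [exact: bdd_cst|move=> i; exact: mdist_ge0].
(* Freezing each coordinate as soon as it stops being fast Cauchy. *)
pose w := fix w (k : nat) (i : I) : M i :=
  if k is k'.+1 then if `[< good i k >] then u k i else w k' i else u 0%N i.
have wgood i k : good i k -> w k i = u k i by case: k => [//|k] g /=; case: asboolP.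
have hw i k : mdist (w k i) (w k.+1 i) <= (C + 1) * 2^-1 ^+ k.
  rewrite /=; case: asboolP => [g|_]; last first.
    by rewrite mdistxx mulr_ge0 ?addr_ge0// ltW.
  by rewrite wgood ?ltW//; [exact: g|move=> j jk; apply: g; exact: ltnW].
have cauchy_w i k m : mdist (w k i) (w (k + m)%N i) <= 2 * (C + 1) * 2^-1 ^+ k.
  apply: (geo_dist (u := fun k => w k i) (@mdistxx _ _) (fun y x z => metric_triangle x y z)) => //.
  by rewrite addr_ge0.
have limw i : exists x : M i, forall k, mdist (w k i) x <= 2 * (C + 1) * 2^-1 ^+ k.
  have [x [B hB]] := complete_geo (@carrier_complete _ _ (M i)) (hw i).
  (* The constant [B] depends on [i]. Passing through a far term of the sequence makes its
     contribution at most [e] and leaves a constant common to all indices. *)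
  exists x => k; apply/ler_addgt0Pl => e e0.
  have [j hj] := geo_small B e0.
  rewrite (le_trans (metric_triangle _ (w (k + j)%N i) _))// addrC lerD//.
  rewrite (le_trans (hB _))// (le_trans _ (ltW hj))//.
  have B0 : 0 <= B by have := le_trans (mdist_ge0 _ _) (hB 0%N); rewrite mulr1.
  by rewrite ler_wpM2l// exprD ler_piMl ?(ltW (p0 _))// exprn_ile1 ?invr_ge0// invf_le1 ?ler1n.
exists (fun i => sval (cid (limw i))), (2 * (C + 1)) => k.
apply: ultra_mean_le => //; apply: filterS (ngood k) => i /wgood <-.
exact: (svalP (cid (limw i)) k).
Qed.

End ultrafilter_mean.

(** An ultrafilter on the space of functionals serves as its own index set: realizing each type [q]
    in a model [M q], the ultraproduct of these models realizes the limit of the ultrafilter. *)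
Lemma aff_types_compact {R : realType} {L : signature R} (T : theory L) n :
  compact (@aff_types _ _ T n : set {ptws formula L n -> R}).
Proof.
rewrite compact_ultra => F UF FA.
have [q0 [M0 [M0T [a0 _]]]] := filter_ex FA.
(* Functionals that are not types get the default model [M0]. They form a set outside the
   ultrafilter and do not influence the limit. *)
have h (q : formula L n -> R^o) : exists Ma : {M : structure L & 'I_n -> M},
    models (projT1 Ma) T /\ (aff_types T q -> q = aff_type (projT2 Ma)).
  have [[M [MT [a qa]]]|nq] := pselect (aff_types T q).
    by exists (existT (fun M : structure L => 'I_n -> M) M a).
  by exists (existT (fun M : structure L => 'I_n -> M) M0 a0).
have [Ma hMa] := choice h.
pose M q := projT1 (Ma q); pose a (j : 'I_n) : forall q, M q := fun q => projT2 (Ma q) j.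
pose N := umean (ultra_complete (UF := UF) (M := M)).
pose b : 'I_n -> N := qpi (X := umean_pre (ultra_complete (UF := UF) (M := M))) \o a.
exists (aff_type b); split.
  by exists N; split; [apply: models_umean => q; exact: (hMa q).1|exists b].
apply: ptws_cvg => phi; rewrite /aff_type los /=.
have bf : bdd (fun q => feval phi (projT2 (Ma q))).
  by exists (fbound phi) => q; exact: feval_bound.
apply: cvg_trans (@ultra_cvg _ _ _ UF _ bf).
apply: near_eq_cvg; apply: filterS FA => q hq.
by rewrite [in RHS]((hMa q).2 hq).
Qed.

Section mixture.
Context {R : realType} (t : R) (t0 : 0 < t) (t1 : t < 1).

Let mix (f : bool -> R) := t * f true + (1 - t) * f false.

Definition mix_mean : @mean R bool.
Proof.
apply: (@Mean _ _ mix); rewrite /mix.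
- by move=> f g _ _; ring.
- by move=> r f _; ring.
- by move=> f g _ _ h; rewrite lerD// ler_wpM2l// ?subr_ge0 ltW.
- by move=> c; ring.
Defined.

Context {L : signature R} (M : bool -> structure L).

Lemma mix_complete : geo_complete (umean_dist mix_mean (M := M)).
Proof.
move=> u C hu.
have s0 : 0 < 1 - t by rewrite subr_gt0.
have h1 k : mdist (u k true) (u k.+1 true) <= t^-1 * C * 2^-1 ^+ k.
  rewrite -mulrA mulrC ler_pdivlMr// mulrC; apply: le_trans (hu k).
  by rewrite /umean_dist/= /mix lerDl mulr_ge0 ?mdist_ge0// ltW.
have h2 k : mdist (u k false) (u k.+1 false) <= (1 - t)^-1 * C * 2^-1 ^+ k.
  rewrite -mulrA mulrC ler_pdivlMr// mulrC; apply: le_trans (hu k).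
  by rewrite /umean_dist/= /mix lerDr mulr_ge0 ?mdist_ge0// ltW.
have [x [B hB]] := complete_geo (@carrier_complete _ _ (M true)) h1.
have [y [D hD]] := complete_geo (@carrier_complete _ _ (M false)) h2.
exists (fun b => if b return M b then x else y), (t * B + (1 - t) * D) => k.
by rewrite /umean_dist/= /mix [leRHS]mulrDl -!mulrA lerD// ler_wpM2l// ltW.
Qed.

End mixture.

Lemma aff_types_mix {R : realType} {L : signature R} (T : theory L) n
    (p q : formula L n -> R^o) (t : R) :
  aff_types T p -> aff_types T q -> 0 <= t -> t <= 1 ->
  aff_types T (fun phi => t * p phi + (1 - t) * q phi).
Proof.
move=> Ap Aq; rewrite !le_eqVlt => /orP[/eqP <- _|t0 /orP[/eqP ->|t1]].
(* The weights 0 and 1 are treated apart, because completeness of the mixture is obtained by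
   dividing by both weights. *)
- by under eq_fun do rewrite mul0r add0r subr0 mul1r.
- by under eq_fun do rewrite mul1r subrr mul0r addr0.
move: Ap Aq => [N [NT [a ->]]] [K [KT [b ->]]].
pose M c := if c then N else K.
pose w : 'I_n -> forall c, M c := fun j c => if c return M c then a j else b j.
pose X := umean_pre (mix_complete (t0 := t0) (t1 := t1) (M := M)).
exists (quotient X); split; first by apply: models_umean; case.
exists (qpi (X := X) \o w); apply/funext => phi.
by rewrite /aff_type los.
Qed.

Lemma aff_types_convex {R : realType} {L : signature R} (T : theory L) n :
  convex_set (@aff_types _ _ T n : set (convex_lmodType (formula L n -> R^o))).
Proof.
move=> p q t; rewrite !inE => Ap Aq.
exact: (aff_types_mix Ap Aq (ge0 t) (le1 t)).
Qed.

(** * Renaming of variables and amalgamation of types *)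

Section renaming.
Context {R : realType} {L : signature R}.

Definition up n m (rho : 'I_n -> 'I_m) : 'I_n.+1 -> 'I_m.+1 :=
  extend ord0 (lift ord0 \o rho).

Lemma extend0 (T : Type) n (x : T) (v : 'I_n -> T) : extend x v ord0 = x.
Proof. by rewrite /extend unlift_none. Qed.

Lemma extendS (T : Type) n (x : T) (v : 'I_n -> T) i : extend x v (lift ord0 i) = v i.
Proof. by rewrite /extend liftK. Qed.

Lemma extend_lift (T : Type) n (x : T) (v : 'I_n -> T) : extend x v \o lift ord0 = v.
Proof. by apply/funext => i; rewrite /= extendS. Qed.

Lemma extend_eta (T : Type) n (w : 'I_n.+1 -> T) : w = extend (w ord0) (w \o lift ord0).
Proof. by apply/funext => i; rewrite /extend; case: unliftP => [j ->|->]. Qed.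

Lemma extend_up (T : Type) n m (rho : 'I_n -> 'I_m) (x : T) (w : 'I_m -> T) :
  extend x w \o up rho = extend x (w \o rho).
Proof.
apply/funext => i; rewrite /up /=.
by case: (unliftP ord0 i) => [j ->|->]; rewrite ?extendS ?extend0 //= extendS.
Qed.

Fixpoint tren n m (rho : 'I_n -> 'I_m) (t : term L n) : term L m :=
  match t with
  | TVar i => TVar (rho i)
  | TApp f a => TApp f (fun i => tren rho (a i))
  end.

Fixpoint fren n (phi : formula L n) m : ('I_n -> 'I_m) -> formula L m :=
  match phi in formula _ n return ('I_n -> 'I_m) -> formula L m with
  | FConst _ r => fun=> FConst r
  | FDist _ s t => fun rho => FDist (tren rho s) (tren rho t)
  | FPred _ P a => fun rho => FPred P (fun i => tren rho (a i))
  | FAdd _ p q => fun rho => FAdd (fren p rho) (fren q rho)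
  | FScale _ r p => fun rho => FScale r (fren p rho)
  | FSup _ p => fun rho => FSup (fren p (up rho))
  | FInf _ p => fun rho => FInf (fren p (up rho))
  end.

Variable M : structure L.

Lemma teval_tren n m (rho : 'I_n -> 'I_m) (w : 'I_m -> M) t :
  teval w (tren rho t) = teval (w \o rho) t.
Proof. by elim: t => [//|f a IH] /=; congr finterp; apply/funext. Qed.

Lemma feval_fren n (phi : formula L n) m (rho : 'I_n -> 'I_m) (w : 'I_m -> M) :
  feval (fren phi rho) w = feval phi (w \o rho).
Proof.
elim: phi m rho w => [//|{}n s t|{}n P a|{}n p IHp q IHq|{}n r p IH|{}n p IH|{}n p IH] m rho w /=.
- by rewrite !teval_tren.
- by congr pinterp; apply/funext => i; rewrite teval_tren.
- by rewrite IHp IHq.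
- by rewrite IH.
- by congr (sup _); apply: eq_imagel => x _; rewrite IH extend_up.
- by congr (inf _); apply: eq_imagel => x _; rewrite IH extend_up.
Qed.

Definition fwk n (phi : formula L n) : formula L n.+1 := fren phi (lift ord0).

Lemma feval_fwk n (phi : formula L n) x (v : 'I_n -> M) :
  feval (fwk phi) (extend x v) = feval phi v.
Proof. by rewrite feval_fren extend_lift. Qed.

End renaming.

(** * Systems of affine equations on compact convex sets *)

Section compact_solve.
Context {R : realType} {X : topologicalType} (K : set X) (cK : compact K).

Lemma compact_closed_family (J : Type) (D : J -> set X) :
  (forall j, closed (D j)) ->
  (forall l : seq J, foldr (fun j A => D j `&` A) K l !=set0) ->
  exists2 x, K x & forall j, D j x.
Proof.
move=> cD fin; pose W l := foldr (fun j A => D j `&` A) K l.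
have WK l : W l `<=` K by elim: l => [//|j l IH] x [_ /IH].
have Wcat l l' : W (l ++ l') `<=` W l `&` W l'.
  elim: l => [|j l IH] /= x; first by move=> h; split=> //; exact: (@WK l').
  by move=> [Dx /IH []].
pose F : set_system X := [set A | exists l, W l `<=` A].
have FF : ProperFilter F.
  split; first by move=> [l /(subset_trans _) h]; have [x /h] := fin l; apply.
  split; first by exists [::].
  - move=> A B [l lA] [l' lB]; exists (l ++ l') => x /Wcat [hl hl'].
    by split; [exact: lA|exact: lB].
  - by move=> A B AB [l lA]; exists l; exact: subset_trans AB.
have [x [Kx xF]] : K `&` cluster F !=set0 by apply: cK; exists [::].
exists x => // j; apply: cD => B xB.
by apply: xF => //; exists [:: j] => z [].
Qed.

Lemma sum_sq_mix (J : Type) (a b : J -> R) (s t : R) (l : seq J) :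
  \sum_(j <- l) (s * a j + t * b j) ^+ 2 =
  s ^+ 2 * (\sum_(j <- l) a j ^+ 2) + 2 * s * t * (\sum_(j <- l) a j * b j)
  + t ^+ 2 * (\sum_(j <- l) b j ^+ 2).
Proof.
by elim: l => [|j l IH]; rewrite ?big_nil ?big_cons ?IH; ring.
Qed.

(* The minimum of a sum of squares of affine functions over a convex set is
   a common zero, unless a linear combination of them is bounded away from 0. *)
Lemma affine_solve (J : Type) (f : J -> X -> R) :
  (forall j, continuous (f j)) ->
  (forall x y (s : R), K x -> K y -> 0 <= s -> s <= 1 ->
    exists2 z, K z & forall j, f j z = s * f j x + (1 - s) * f j y) ->
  (forall (l : seq (R * J)) (e : R), 0 < e ->
    exists2 x, K x & - e <= \sum_(c <- l) c.1 * f c.2 x) ->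
  exists2 x, K x & forall j, f j x = 0.
Proof.
move=> cf mix sep.
apply: (@compact_closed_family _ (fun j => f j @^-1` [set 0])) => [j|l].
  by apply: closed_comp => [x _|]; [exact: cf|exact: closed_eq].
pose F x := \sum_(j <- l) f j x ^+ 2.
have F0 x : 0 <= F x by apply: sumr_ge0 => j _; exact: sqr_ge0.
have cF : continuous F.
  rewrite /F; elim: {F F0} l => [|j l IH] x.
    by under eq_fun do rewrite big_nil; exact: cvg_cst.
  under eq_fun do rewrite big_cons.
  by apply: cvgD; [under eq_fun do rewrite expr2; apply: cvgM; exact: cf|exact: IH].
have K0 : K !=set0 by have [x Kx _] := sep [::] 1 ltr01; exists x.
have [x0 /set_mem Kx0 hmin] := compact_EVT_min K0 cK (continuous_subspaceT cF).
suff Fx0 : F x0 = 0.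
  exists x0; move: Fx0; rewrite /F; elim: (l) => [//|j l' IH].
  move/eqP; rewrite big_cons paddr_eq0 ?sqr_ge0 ?sumr_ge0// => [|i _]; last exact: sqr_ge0.
  by rewrite sqrf_eq0 => /andP[/eqP h /eqP/IH]; split.
apply/eqP; apply: contraT => Fn0.
have m0 : 0 < F x0 by rewrite lt_neqAle eq_sym Fn0 F0.
have m2 : 0 < F x0 / 2 by rewrite divr_gt0.
(* The coefficients come from the gradient of [F] at its minimizer [x0]: the combination tested is
   the one that would separate the image of [K] from the origin. *)
have [x1 Kx1] := sep [seq (- f j x0, j) | j <- l] _ m2.
rewrite big_map => hx1.
pose c := \sum_(j <- l) f j x1 * f j x0.
have hc : c <= F x0 / 2.
  rewrite -lerN2 (le_trans hx1)// /c -sumrN ler_sum// => j _ /=.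
  by rewrite mulNr mulrC.
have q0 := F0 x1.
(* With [c <= F x0 / 2], the value of [F] at weight [s] on [x1] is at most
   [s ^+ 2 * F x1 + (1 - s) * F x0]. This is below [F x0] as soon as [s * F x1 < F x0], which the
   chosen [s] ensures. *)
pose s := F x0 / (2 * (F x1 + F x0)).
have d0 : 0 < F x1 + F x0 by rewrite ltr_wpDl.
have s0 : 0 < s by rewrite divr_gt0// mulr_gt0.
have sd : s * (2 * (F x1 + F x0)) = F x0 by rewrite /s mulfVK// gt_eqF// mulr_gt0.
have s1 : s <= 1 by rewrite ler_pdivrMr ?mulr_gt0// mul1r; lra.
have [z Kz hz] := mix x1 x0 s Kx1 Kx0 (ltW s0) s1.
have /mem_set/hmin : K z by [].
rewrite leNgt => /negP[]; rewrite [ltLHS](_ : _ = s ^+ 2 * F x1 + 2 * s * (1 - s) * c + (1 - s) ^+ 2 * F x0); last first.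
  by rewrite /F /c -sum_sq_mix; apply: eq_bigr => j _; rewrite hz.
have : 2 * s * (1 - s) * c <= s * (1 - s) * F x0.
  rewrite (_ : s * (1 - s) * F x0 = 2 * s * (1 - s) * (F x0 / 2)); last by field.
  apply: ler_wpM2l hc; apply: mulr_ge0; last by rewrite subr_ge0.
  by apply: mulr_ge0 => //; exact: ltW.
have : s * (s * F x1) < s * F x0 by rewrite ltr_pM2l//; nra.
by move=> h1 h2; nra.
Qed.

End compact_solve.

Section amalgamation.
Context {R : realType} {L : signature R} (T : theory L).

(** By [affine_solve], it suffices to nearly satisfy one linear combination of the constraints at a
    time. Those on the old variables vanish at every extension of [b] and [c], and the others add up
    to one formula [psi]. Near-maximizers of [psi] over [b] and over [c] are good enough: the
    average of the two suprema is the value of [r] at [fwk (FSup psi)], which is at least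
    [r psi]. *)
Lemma amalgamation n (x y : formula L n -> R^o) (r : formula L n.+1 -> R^o) (t : R) :
  aff_types T x -> aff_types T y -> aff_types T r -> 0 <= t -> t <= 1 ->
  (forall phi, r (fwk phi) = t * x phi + (1 - t) * y phi) ->
  exists x' y', [/\ aff_types T x', aff_types T y',
    forall phi, x' (fwk phi) = x phi, forall phi, y' (fwk phi) = y phi &
    forall psi, r psi = t * x' psi + (1 - t) * y' psi].
Proof.
move=> [N [NT [b ->]]] [K [KT [c ->]]] [Q [QT [w ->]]] t0 t1 hr.
have s0 : 0 <= 1 - t by rewrite subr_ge0.
pose P := {ptws formula L n.+1 -> R}.
pose S : set P := @aff_types _ _ T n.+1.
pose f (j : formula L n + formula L n + formula L n.+1) (z : P * P) : R :=
  match j with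
  | inl (inl phi) => z.1 (fwk phi) - feval phi b
  | inl (inr phi) => z.2 (fwk phi) - feval phi c
  | inr psi => t * z.1 psi + (1 - t) * z.2 psi - feval psi w
  end.
have e1 (psi : formula L n.+1) : continuous (fun z : P * P => z.1 psi).
  move=> z; apply: (@continuous_comp _ _ _ (fun u : P * P => u.1) (fun g : P => g psi)).
    exact: cvg_fst.
  exact: ptws_eval_continuous.
have e2 (psi : formula L n.+1) : continuous (fun z : P * P => z.2 psi).
  move=> z; apply: (@continuous_comp _ _ _ (fun u : P * P => u.2) (fun g : P => g psi)).
    exact: cvg_snd.
  exact: ptws_eval_continuous.
have [] := @affine_solve R _ (S `*` S) (compact_setX _ _) _ f; try exact: aff_types_compact.
- move=> [[phi|phi]|psi] z /=.
  + exact: (@cvgB R R _ (nbhs z) _ (fun u => u.1 (fwk phi)) _ _ _ (e1 _ z) (cvg_cst _)).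
  + exact: (@cvgB R R _ (nbhs z) _ (fun u => u.2 (fwk phi)) _ _ _ (e2 _ z) (cvg_cst _)).
  + have h1 := @cvgMl_tmp R _ (nbhs z) (nbhs_filter z) (fun u : P * P => u.1 psi) t _ (e1 _ z).
    have h2 := @cvgMl_tmp R _ (nbhs z) (nbhs_filter z) (fun u : P * P => u.2 psi) (1 - t) _ (e2 _ z).
    have h3 := @cvgD R R _ (nbhs z) (nbhs_filter z) _ _ _ _ h1 h2.
    exact: (@cvgB R R _ (nbhs z) _ _ (fun=> feval psi w) _ _ h3 (cvg_cst _)).
- move=> z z' s [z1 z2] [z1' z2'] hs0 hs1.
  exists (fun psi => s * z.1 psi + (1 - s) * z'.1 psi,
          fun psi => s * z.2 psi + (1 - s) * z'.2 psi).
    by split; exact: aff_types_mix.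
  by move=> [[phi|phi]|psi] /=; ring.
- move=> l e e0.
  pose psi := foldr (fun (cj : R * (formula L n + formula L n + formula L n.+1)) acc =>
    if cj.2 is inr psi then FAdd (FScale cj.1 psi) acc else acc) (FConst 0) l.
  have [d hd] := sup_range_near (carrier_nonempty N)
    (fun d => feval_bound psi (extend d b)) e0.
  have [d' hd'] := sup_range_near (carrier_nonempty K)
    (fun d => feval_bound psi (extend d c)) e0.
  exists (aff_type (extend d b), aff_type (extend d' c)).
    by split; [exists N; split=> //; exists (extend d b)|exists K; split=> //; exists (extend d' c)].
  rewrite [leRHS](_ : _ = t * feval psi (extend d b) + (1 - t) * feval psi (extend d' c)
      - feval psi w); last first.
    rewrite /psi {hd hd' psi}; elim: l => [|[k [[phi|phi]|psi]] l IH] /=.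
    + by rewrite big_nil; ring.
    + by rewrite big_cons IH /= /aff_type feval_fwk; ring.
    + by rewrite big_cons IH /= /aff_type feval_fwk; ring.
    + by rewrite big_cons IH /= /aff_type; ring.
  have hs : feval psi w <= feval (FSup psi) (w \o lift ord0).
    rewrite {1}(extend_eta w).
    exact: (le_sup_range (fun d => feval_bound psi (extend d (w \o lift ord0)))).
  have := hr (FSup psi); rewrite /aff_type feval_fren => hw.
  move: hs; rewrite hw /= => hs.
  have h1 := ler_wpM2l t0 (ltW hd); have h2 := ler_wpM2l s0 (ltW hd').
  lra.
move=> [x' y'] [/= Sx' Sy'] h; exists x', y'; split=> //.
- by move=> phi; apply/eqP; rewrite -subr_eq0; apply/eqP; exact: (h (inl (inl phi))).
- by move=> phi; apply/eqP; rewrite -subr_eq0; apply/eqP; exact: (h (inl (inr phi))).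
- by move=> psi; apply/eqP; rewrite eq_sym -subr_eq0; apply/eqP; exact: (h (inr psi)).
Qed.

End amalgamation.

(** * Probability algebras *)

Section axioms.
Context {R : realType} {L : signature R} (M : structure L).

Lemma inf_closure_ge0 n (phi : formula L n) (v : 'I_0 -> M) :
  0 <= feval (inf_closure phi) v <-> forall w : 'I_n -> M, 0 <= feval phi w.
Proof.
elim: n phi => [|n IH] phi /=.
  by split=> [h w|//]; rewrite (_ : w = v)//; apply/funext => -[].
rewrite IH; split=> [h w|h w].
  rewrite (extend_eta w); apply: le_trans (h (w \o lift ord0)) _.
  exact: (inf_range_le (fun x => feval_bound phi (extend x (w \o lift ord0)))).
by apply: le_inf_range => //; exact: carrier_nonempty.
Qed.

Lemma ax_teqP n (s t : term L n) (v : 'I_0 -> M) :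
  0 <= feval (ax_teq s t) v <-> forall w : 'I_n -> M, teval w s = teval w t.
Proof.
rewrite inf_closure_ge0; split=> h w; have := h w; rewrite /= mulN1r oppr_ge0.
  by move=> hd; apply: mdist_positivity; apply: le_anti; rewrite hd mdist_ge0.
by move=> ->; rewrite mdistxx.
Qed.

Lemma ax_geP n (p q : formula L n) (v : 'I_0 -> M) :
  0 <= feval (ax_ge p q) v <-> forall w : 'I_n -> M, feval q w <= feval p w.
Proof.
by rewrite inf_closure_ge0; split=> h w; have := h w; rewrite /= mulN1r subr_ge0.
Qed.

End axioms.

Section boolean_operations.
Context {R : realType} {Gamma : groupType}.
Local Notation sig := (@pmp_sig R Gamma).

Section operations.
Context (M : structure sig).
Implicit Types x y : M.

Definition cup x y : M := @finterp _ _ M (Cup Gamma : fsym sig) (tnth [tuple x; y]).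
Definition cap x y : M := @finterp _ _ M (Cap Gamma : fsym sig) (tnth [tuple x; y]).
Definition neg x : M := @finterp _ _ M (Neg Gamma : fsym sig) (tnth [tuple x]).
Definition zero : M := @finterp _ _ M (Zero Gamma : fsym sig) (tnth [tuple]).
Definition one : M := @finterp _ _ M (One Gamma : fsym sig) (tnth [tuple]).
Definition act (g : Gamma) x : M := @finterp _ _ M (Act g : fsym sig) (tnth [tuple x]).
Definition mu x : R := @pinterp _ _ M (tt : psym sig) (tnth [tuple x]).
Definition sdiff x y := cup (cap x (neg y)) (cap y (neg x)).

Variables (n : nat) (w : 'I_n -> M).

Lemma tuple2_comp (A B : Type) (h : A -> B) (a b : A) :
  (fun i => h (tnth [tuple a; b] i)) = tnth [tuple h a; h b].
Proof. by apply/funext => -[[|[|//]] i]. Qed.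
Lemma tuple1_comp (A B : Type) (h : A -> B) (a : A) :
  (fun i => h (tnth [tuple a] i)) = tnth [tuple h a].
Proof. by apply/funext => -[[|//] i]. Qed.
Lemma tuple0_comp (A B : Type) (h : A -> B) :
  (fun i => h (tnth [tuple] i)) = tnth [tuple].
Proof. by apply/funext => -[]. Qed.

Lemma pmp_tevalE :
  (forall s t, teval w (tcup s t) = cup (teval w s) (teval w t)) *
  (forall s t, teval w (tcap s t) = cap (teval w s) (teval w t)) *
  (forall s, teval w (tneg s) = neg (teval w s)) *
  (teval w (@tzero R Gamma n) = zero) * (teval w (@tone R Gamma n) = one) *
  (forall g s, teval w (tact g s) = act g (teval w s)).
Proof.
by do ![split] => *; rewrite /= ?tuple2_comp ?tuple1_comp ?tuple0_comp.
Qed.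

Lemma teval_tsymdiff s t : teval w (tsymdiff s t) = sdiff (teval w s) (teval w t).
Proof. by rewrite /tsymdiff !pmp_tevalE. Qed.

Lemma feval_fmu s : feval (fmu s) w = mu (teval w s).
Proof. by rewrite /fmu fevalE /mu -tuple1_comp. Qed.

Lemma finterp_pmp (f : fsym sig) (a : 'I_(farity f) -> M) : finterp a =
  match f as f0 return ('I_(pmp_arity f0) -> M) -> M with
  | Cup => fun a => cup (a ord0) (a ord_max)
  | Cap => fun a => cap (a ord0) (a ord_max)
  | Neg => fun a => neg (a ord0)
  | Zero => fun=> zero
  | One => fun=> one
  | Act g => fun a => act g (a ord0)
  end a.
Proof.
case: f a => [|||||g] a; congr finterp; apply/funext.
- by case=> -[|[|//]] i; congr a; apply: val_inj.
- by case=> -[|[|//]] i; congr a; apply: val_inj.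
- by case=> -[|//] i; congr a; apply: val_inj.
- by case.
- by case.
- by case=> -[|//] i; congr a; apply: val_inj.
Qed.

Lemma pinterp_pmp (P : psym sig) (a : 'I_(parity P) -> M) : pinterp a = mu (a ord0).
Proof.
case: P a => a; congr pinterp; apply/funext => -[[|//] i].
by congr a; apply: val_inj.
Qed.

End operations.

Section models_of_PMP.
Context (M : structure sig) (MP : models M (PMP R Gamma)).
Implicit Types x y z e : M.

Let v0 : 'I_0 -> M := fun=> sval (cid (carrier_nonempty M)).

Let teq n (s t : term sig n) (w : 'I_n -> M) :
  PMP R Gamma (ax_teq s t) -> teval w s = teval w t.
Proof. by move=> h; apply: (iffLR (ax_teqP s t v0)); exact: MP. Qed.

Let feq n (p q : formula sig n) (w : 'I_n -> M) :
  ax_eq p q `<=` PMP R Gamma -> feval p w = feval q w.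
Proof.
move=> h; apply: le_anti; apply/andP; split.
  by apply: (iffLR (ax_geP q p v0)); apply: MP; apply: h; right.
by apply: (iffLR (ax_geP p q v0)); apply: MP; apply: h; left.
Qed.

Let bool_teq n (s t : term sig n) (w : 'I_n -> M) :
  @boolean_axioms R Gamma (ax_teq s t) -> teval w s = teval w t.
Proof. by move=> h; apply: teq; left; left; left. Qed.

Let w3 x y z : 'I_3 -> M := tnth [tuple x; y; z].

Lemma pcupC x y : cup x y = cup y x.
Proof. by have := bool_teq (w3 x y x) (@cupC R Gamma); rewrite !pmp_tevalE. Qed.
Lemma pcapC x y : cap x y = cap y x.
Proof. by have := bool_teq (w3 x y x) (@capC R Gamma); rewrite !pmp_tevalE. Qed.
Lemma pcapA x y z : cap x (cap y z) = cap (cap x y) z.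
Proof. by have := bool_teq (w3 x y z) (@capA R Gamma); rewrite !pmp_tevalE. Qed.
Lemma pcupKI x y : cup x (cap x y) = x.
Proof. by have := bool_teq (w3 x y x) (@cupKI R Gamma); rewrite !pmp_tevalE. Qed.
Lemma pcapKU x y : cap x (cup x y) = x.
Proof. by have := bool_teq (w3 x y x) (@capKU R Gamma); rewrite !pmp_tevalE. Qed.
Lemma pcapUr x y z : cap x (cup y z) = cup (cap x y) (cap x z).
Proof. by have := bool_teq (w3 x y z) (@capUr R Gamma); rewrite !pmp_tevalE. Qed.
Lemma pcupN x : cup x (neg x) = one M.
Proof. by have := bool_teq (w3 x x x) (@cupN R Gamma); rewrite !pmp_tevalE. Qed.
Lemma pcapN x : cap x (neg x) = zero M.
Proof. by have := bool_teq (w3 x x x) (@capN R Gamma); rewrite !pmp_tevalE. Qed.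

Lemma mu_one : mu (one M) = 1.
Proof.
have := @feq 0 (fmu (@tone R Gamma 0)) (FConst 1) v0; rewrite feval_fmu pmp_tevalE; apply.
by move=> p hp; left; left; right; left; left.
Qed.

Lemma mu_modular x y : mu (cup x y) + mu (cap x y) = mu x + mu y.
Proof.
have := @feq 3 _ _ (w3 x y x) (fun p hp => or_introl (or_introl (or_intror (or_introl (or_intror hp))))).
by rewrite !(feval_fmu, fevalE) !pmp_tevalE.
Qed.

Lemma mdist_mu x y : mdist x y = mu (sdiff x y).
Proof.
have := @feq 3 _ _ (w3 x y x) (fun p hp => or_introl (or_introl (or_intror (or_intror hp)))).
by rewrite !(feval_fmu, fevalE) teval_tsymdiff.
Qed.

Let emb g n (s t : term sig n) (w : 'I_n -> M) :
  @embedding_axioms R Gamma g (ax_teq s t) -> teval w s = teval w t.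
Proof. by move=> h; apply: teq; left; right; exists g. Qed.

Lemma act_cup g x y : act g (cup x y) = cup (act g x) (act g y).
Proof.
by have := emb (w3 x y x) (or_introl (or_introl (or_introl (or_introl
  (or_introl (or_introl (erefl (ax_teq (tact g _) _)))))))); rewrite !pmp_tevalE.
Qed.
Lemma act_cap g x y : act g (cap x y) = cap (act g x) (act g y).
Proof.
by have := emb (w3 x y x) (or_introl (or_introl (or_introl (or_introl
  (or_introl (or_intror (erefl (ax_teq (tact g _) _)))))))); rewrite !pmp_tevalE.
Qed.
Lemma act_neg g x : act g (neg x) = neg (act g x).
Proof.
by have := emb (w3 x x x) (or_introl (or_introl (or_introl (or_introl
  (or_intror (erefl (ax_teq (tact g _) _))))))); rewrite !pmp_tevalE.
Qed.
Lemma act_zero g : act g (zero M) = zero M.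
Proof.
by have := emb v0 (or_introl (or_introl (or_introl
  (or_intror (erefl (ax_teq (tact g _) _)))))); rewrite !pmp_tevalE.
Qed.
Lemma act_one g : act g (one M) = one M.
Proof.
by have := emb v0 (or_introl (or_introl
  (or_intror (erefl (ax_teq (tact g _) _))))); rewrite !pmp_tevalE.
Qed.

Lemma mu_act g x : mu (act g x) = mu x.
Proof.
have := @feq 3 (fmu (tact g (TVar (@Ordinal 3 0 isT)))) (fmu (TVar (@Ordinal 3 0 isT))) (w3 x x x).
rewrite !feval_fmu !pmp_tevalE; apply => p hp.
by left; right; exists g => //; left; right.
Qed.

Lemma act_sdiff g x y : act g (sdiff x y) = sdiff (act g x) (act g y).
Proof. by rewrite /sdiff act_cup !act_cap !act_neg. Qed.

Lemma pcapxx x : cap x x = x.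
Proof. by rewrite -{2}(pcupKI x x) pcapKU. Qed.
Lemma pcupxx x : cup x x = x.
Proof. by rewrite -{2}(pcapxx x) pcupKI. Qed.
Lemma pcap_zero x : cap x (zero M) = zero M.
Proof. by rewrite -(pcapN x) pcapA pcapxx. Qed.
Lemma pcup_zero x : cup x (zero M) = x.
Proof. by rewrite -(pcap_zero x) pcupKI. Qed.
Lemma pcap_one x : cap x (one M) = x.
Proof. by rewrite -(pcupN x) pcapKU. Qed.

Lemma mu_zero : mu (zero M) = 0.
Proof. by rewrite -(mdistxx (zero M)) mdist_mu /sdiff pcupxx pcapN. Qed.

Lemma neg_zero : neg (zero M) = one M.
Proof. by rewrite -(pcup_zero (neg _)) pcupC pcupN. Qed.

Lemma mu_disjoint x y : cap x y = zero M -> mu (cup x y) = mu x + mu y.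
Proof. by move=> h; rewrite -mu_modular h mu_zero addr0. Qed.

Lemma mu_split x e : mu x = mu (cap x e) + mu (cap x (neg e)).
Proof.
rewrite -mu_disjoint -?pcapUr ?pcupN ?pcap_one//.
by rewrite -pcapA (pcapC x (neg e)) (pcapA e) pcapN [cap _ x]pcapC !pcap_zero.
Qed.

Lemma mu_ge0 x : 0 <= mu x.
Proof.
have <- : sdiff x (zero M) = x.
  by rewrite /sdiff neg_zero pcap_one [cap (zero M) _]pcapC pcap_zero pcup_zero.
by rewrite -mdist_mu mdist_ge0.
Qed.

End models_of_PMP.


(** * Linear inequalities between measures, decided by truth tables *)

Inductive bterm := BVar of nat | BCup of bterm & bterm | BCap of bterm & bterm
  | BNeg of bterm | BZero | BOne.

Fixpoint beval (b : nat -> bool) (t : bterm) : bool :=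
  match t with
  | BVar i => b i
  | BCup s t => beval b s || beval b t
  | BCap s t => beval b s && beval b t
  | BNeg s => ~~ beval b s
  | BZero => false
  | BOne => true
  end.

Section truth_tables.
Context (M : structure sig) (MP : models M (PMP R Gamma)).
Implicit Types x y z : M.

Fixpoint bden (v : nat -> M) (t : bterm) : M :=
  match t with
  | BVar i => v i
  | BCup s t => cup (bden v s) (bden v t)
  | BCap s t => cap (bden v s) (bden v t)
  | BNeg s => neg (bden v s)
  | BZero => zero M
  | BOne => one M
  end.

Let lit (v : nat -> M) (b : nat -> bool) i := if b i then v i else neg (v i).

(** An element below one literal of each variable behaves like an atom of the generated algebra:
    every term contains it or misses it, as the valuation [b] dictates. *)
Lemma cap_bden v b z t : (forall i, cap z (lit v b i) = z) ->
  cap z (bden v t) = if beval b t then z else zero M.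
Proof.
move=> hz; elim: t => [i|s IHs t IHt|s IHs t IHt|s IHs||] /=.
- rewrite -{1 2}(hz i) /lit; case: (b i); first by rewrite -pcapA// pcapxx.
  by rewrite -pcapA// [cap (neg _) _]pcapC// pcapN// pcap_zero.
- rewrite pcapUr// IHs IHt; case: (beval b s); case: (beval b t) => //=.
  + by rewrite pcupxx.
  + by rewrite pcup_zero.
  + by rewrite pcupC// pcup_zero.
  + by rewrite pcupxx.
- rewrite pcapA// IHs; case: (beval b s) => //=.
  by rewrite pcapC// pcap_zero.
- case: (beval b s) IHs => /= h; last first.
    have := pcap_one MP z; rewrite -(pcupN MP (bden v s)) pcapUr// h.
    by rewrite pcupC// pcup_zero.
  by rewrite -h -pcapA// pcapN// pcap_zero.
- by rewrite pcap_zero.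
- by rewrite pcap_one.
Qed.

Definition bsum (b : nat -> bool) (T : seq (R * bterm)) : R :=
  foldr (fun c s => c.1 * (beval b c.2)%:R + s) 0 T.
Definition musum (v : nat -> M) (T : seq (R * bterm)) : R :=
  foldr (fun c s => c.1 * mu (bden v c.2) + s) 0 T.

(** The unit is split into the atoms of the algebra generated by [l]. On an atom the sum is the
    measure of that atom times a row of the truth table. *)
Lemma musum_ge0 (l : seq M) (T : seq (R * bterm)) :
  (forall b, 0 <= bsum b T) -> 0 <= musum (nth (zero M) l) T.
Proof.
move=> hT; set v := nth _ l.
pose S z := foldr (fun c s => c.1 * mu (cap z (bden v c.2)) + s) 0 T.
have Ssplit z e : S z = S (cap z e) + S (cap z (neg e)).
  rewrite /S; elim: (T) => [|c T' IH] /=; first by rewrite addr0.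
  rewrite IH (mu_split MP (cap z _) e) -!pcapA//.
  by rewrite ![cap (bden _ _) _]pcapC// !pcapA//; ring.
(* The list [s] holds the variables still undecided on [z], and induction splits [z] along one of
   them. Indices beyond [l] denote [zero], so they are decided as false from the start. *)
suff H (s : seq nat) (b : nat -> bool) z : (forall i, i \notin s -> cap z (lit v b i) = z) -> 0 <= S z.
  have -> : musum v T = S (one M).
    by rewrite /musum /S; elim: (T) => //= c T' ->; rewrite [cap _ _]pcapC// pcap_one.
  apply: (H (iota 0 (size l)) (fun=> false)) => i.
  rewrite mem_iota /= add0n -leqNgt => hi.
  by rewrite /lit /v nth_default// neg_zero// pcap_one.
elim: s b z => [|i s IH] b z hz.
  have -> : S z = mu z * bsum b T.
    rewrite /S /bsum; elim: (T) => [|c T' IHT] /=; first by rewrite mulr0.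
    rewrite (@cap_bden v b) => [|i]; last exact: hz.
    by rewrite IHT; case: (beval b _); rewrite /= ?mu_zero//; ring.
  by rewrite mulr_ge0 ?mu_ge0.
pose upd c := fun j => if j == i then c else b j.
rewrite (Ssplit z (v i)) addr_ge0//.
- apply: (IH (upd true)) => j js; rewrite /lit /upd; case: eqVneq => [->|ji].
    by rewrite -pcapA// pcapxx.
  have hj : cap z (if b j then v j else neg (v j)) = z.
    by apply: hz; rewrite inE negb_or ji.
  by rewrite -pcapA// [cap (v i) _]pcapC// pcapA// hj.
- apply: (IH (upd false)) => j js; rewrite /lit /upd; case: eqVneq => [->|ji].
    by rewrite -pcapA// pcapxx.
  have hj : cap z (if b j then v j else neg (v j)) = z.
    by apply: hz; rewrite inE negb_or ji.
  by rewrite -pcapA// [cap (neg (v i)) _]pcapC// pcapA// hj.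
Qed.

End truth_tables.

End boolean_operations.

Ltac bt_index x l :=
  lazymatch l with
  | x :: _ => constr:(0%N)
  | _ :: ?l' => let k := bt_index x l' in constr:(S k)
  end.

Ltac bt_reify l x :=
  lazymatch x with
  | cup ?a ?b => let s := bt_reify l a in let t := bt_reify l b in constr:(BCup s t)
  | cap ?a ?b => let s := bt_reify l a in let t := bt_reify l b in constr:(BCap s t)
  | neg ?a => let s := bt_reify l a in constr:(BNeg s)
  | sdiff ?a ?b => let s := bt_reify l a in let t := bt_reify l b in
      constr:(BCup (BCap s (BNeg t)) (BCap t (BNeg s)))
  | zero _ => constr:(BZero)
  | one _ => constr:(BOne)
  | _ => let k := bt_index x l in constr:(BVar k)
  end.

Ltac bt_reify_sum R l T :=
  lazymatch T with
  | nil => constr:(@nil (R * bterm))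
  | (?c, ?x) :: ?T' => let t := bt_reify l x in let T2 := bt_reify_sum R l T' in
      constr:((c, t) :: T2)
  end.

(* [boolean_inequality MP l T] adds the inequality [0 <= \sum c * mu x] over
   the pairs [(c, x)] of [T], whose entries are Boolean terms in the elements of
   [l], after checking it for all 0/1 valuations of [l] (at most five elements). *)
Ltac boolean_inequality MP l T :=
  lazymatch type of T with
  | seq (?R * _) => let T' := bt_reify_sum R l T in
    have := @musum_ge0 _ _ _ MP l T';
    let b := fresh "b" in
    move=> /(_ ltac:(move=> b; rewrite /bsum /=;
      case: (b 0%N); case: (b 1%N); case: (b 2%N); case: (b 3%N); case: (b 4%N); rewrite /=; lra));
    rewrite /musum /= -/(sdiff _ _)
  end.

(** * Relativization to an invariant element *)

Section glued_bounds.
Context {R : realType} (T : Type) (f g : T -> R) (B : R).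
Hypotheses (T0 : [set: T] !=set0) (fB : forall x, `|f x| <= B) (gB : forall x, `|g x| <= B).
Hypothesis glue : forall x y, exists2 z, f z = f x & g z = g y.

(** In the application [f] sees only the part of an element inside [e] and [g] only the part
    outside, so near-maximizers of both can be glued into one element. *)
Lemma sup_range_glue :
  sup (range (fun x => f x + g x)) = sup (range f) + sup (range g).
Proof.
have fgB x : `|f x + g x| <= B + B by rewrite (le_trans (ler_normD _ _))// lerD.
apply: le_anti; apply/andP; split.
  by apply: sup_range_le => // x; apply: lerD; [exact: (le_sup_range fB)|exact: (le_sup_range gB)].
apply/ler_addgt0Pl => e e0; have e2 : 0 < e / 2 by rewrite divr_gt0.
have [x hx] := sup_range_near T0 fB e2; have [y hy] := sup_range_near T0 gB e2.
have [z zx zy] := glue x y.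
have := le_sup_range fgB z; rewrite zx zy; lra.
Qed.

Lemma inf_range_glue :
  inf (range (fun x => f x + g x)) = inf (range f) + inf (range g).
Proof.
have fgB x : `|f x + g x| <= B + B by rewrite (le_trans (ler_normD _ _))// lerD.
apply: le_anti; apply/andP; split; last first.
  by apply: le_inf_range => // x; apply: lerD; [exact: (inf_range_le fB)|exact: (inf_range_le gB)].
apply/ler_addgt0Pl => e e0; have e2 : 0 < e / 2 by rewrite divr_gt0.
have [x hx] := inf_range_near T0 fB e2; have [y hy] := inf_range_near T0 gB e2.
have [z zx zy] := glue x y.
have := inf_range_le fgB z; rewrite zx zy; lra.
Qed.

End glued_bounds.

Lemma sup_rangeZ {R : realType} (T : Type) (f : T -> R) (B c : R) :
  [set: T] !=set0 -> (forall x, `|f x| <= B) -> 0 <= c ->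
  sup (range (fun x => c * f x)) = c * sup (range f).
Proof.
move=> T0 fB c0.
have cfB x : `|c * f x| <= c * B by rewrite normrM ger0_norm// ler_wpM2l.
apply: le_anti; apply/andP; split.
  by apply: sup_range_le => // x; rewrite ler_wpM2l// (le_sup_range fB).
have [cE|cn0] := eqVneq c 0.
  have [x _] := T0; apply: le_trans (le_sup_range cfB x).
  by rewrite cE !mul0r.
have {}c0 : 0 < c by rewrite lt_neqAle eq_sym cn0.
rewrite -ler_pdivlMl//; apply: sup_range_le => // x.
by rewrite ler_pdivlMl// (le_sup_range cfB).
Qed.

Lemma inf_rangeZ {R : realType} (T : Type) (f : T -> R) (B c : R) :
  [set: T] !=set0 -> (forall x, `|f x| <= B) -> 0 <= c ->
  inf (range (fun x => c * f x)) = c * inf (range f).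
Proof.
move=> T0 fB c0; rewrite !inf_rangeN mulrN -(@sup_rangeZ _ _ _ B)//.
  by under eq_fun do rewrite -mulrN.
by move=> x; rewrite normrN.
Qed.

Section relativization.
Context {R : realType} {Gamma : groupType}.
Local Notation sig := (@pmp_sig R Gamma).

(** Relativization as an operation on syntax, with the cutting element as the variable [j]. The
    renaming [rho] is carried along so that [j] can be shifted under quantifiers. *)
Fixpoint frelat n (phi : formula sig n) m : 'I_m -> ('I_n -> 'I_m) -> formula sig m :=
  match phi in formula _ n return 'I_m -> ('I_n -> 'I_m) -> formula sig m with
  | FConst _ r => fun j _ => FScale r (fmu (TVar j))
  | FDist _ s t => fun j rho => fmu (tcap (tsymdiff (tren rho s) (tren rho t)) (TVar j))
  | FPred _ _ a => fun j rho => fmu (tcap (tren rho (a ord0)) (TVar j))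
  | FAdd _ p q => fun j rho => FAdd (frelat p j rho) (frelat q j rho)
  | FScale _ r p => fun j rho => FScale r (frelat p j rho)
  | FSup _ p => fun j rho => FSup (frelat p (lift ord0 j) (up rho))
  | FInf _ p => fun j rho => FInf (frelat p (lift ord0 j) (up rho))
  end.

Section semantics.
Context (M : structure sig).

Fixpoint rfeval (e : M) n (phi : formula sig n) : ('I_n -> M) -> R :=
  match phi in formula _ n return ('I_n -> M) -> R with
  | FConst _ r => fun=> r * mu e
  | FDist _ s t => fun v => mu (cap (sdiff (teval v s) (teval v t)) e)
  | FPred _ _ a => fun v => mu (cap (teval v (a ord0)) e)
  | FAdd _ p q => fun v => rfeval e p v + rfeval e q v
  | FScale _ r p => fun v => r * rfeval e p v
  | FSup _ p => fun v => sup (range (fun x => rfeval e p (extend x v)))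
  | FInf _ p => fun v => inf (range (fun x => rfeval e p (extend x v)))
  end.

Lemma feval_frelat n (phi : formula sig n) m (j : 'I_m) (rho : 'I_n -> 'I_m) (w : 'I_m -> M) :
  feval (frelat phi j rho) w = rfeval (w j) phi (w \o rho).
Proof.
elim: phi m j rho w => [{}n r|{}n s t|{}n P a|{}n p IHp q IHq|{}n r p IH|{}n p IH|{}n p IH] m j rho w.
- by rewrite [frelat _ _ _]/= fevalE feval_fmu.
- by rewrite [frelat _ _ _]/= feval_fmu !pmp_tevalE !teval_tren.
- by rewrite [frelat _ _ _]/= feval_fmu !pmp_tevalE teval_tren.
- by rewrite [frelat _ _ _]/= fevalE IHp IHq.
- by rewrite [frelat _ _ _]/= fevalE IH.
- rewrite [frelat _ _ _]/= fevalE; congr (sup _); apply: eq_imagel => x _.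
  by rewrite IH extend_up extendS.
- rewrite [frelat _ _ _]/= fevalE; congr (inf _); apply: eq_imagel => x _.
  by rewrite IH extend_up extendS.
Qed.

Hypothesis MP : models M (PMP R Gamma).
Implicit Types (x y e : M).

Lemma mu_eq x y : mu (sdiff x y) <= 0 -> x = y.
Proof.
by move=> h; apply: mdist_positivity; apply: le_anti; rewrite mdist_ge0 mdist_mu// h.
Qed.

Lemma mu_cap_le x e : mu (cap x e) <= mu e.
Proof. by boolean_inequality MP [:: x; e] [:: (1 : R, e); (-1, cap x e)]; lra. Qed.

Lemma rfeval_bound e n (phi : formula sig n) v : `|rfeval e phi v| <= fbound phi * mu e.
Proof.
have e0 := mu_ge0 MP e.
elim: phi v => [{}n r v|{}n s t v|{}n P a v|{}n p IHp q IHq v|{}n r p IH v|{}n p IH v|{}n p IH v] /=.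
- by rewrite normrM (ger0_norm e0).
- by rewrite ger0_norm ?mu_ge0// mul1r mu_cap_le.
- by rewrite ger0_norm ?mu_ge0// mul1r mu_cap_le.
- by rewrite mulrDl (le_trans (ler_normD _ _))// lerD.
- by rewrite normrM -mulrA ler_wpM2l.
- by apply: sup_range_norm => //; exact: carrier_nonempty.
- by apply: inf_range_norm => //; exact: carrier_nonempty.
Qed.

Definition invariant e := forall g, act g e = e.

Lemma invariant_neg e : invariant e -> invariant (neg e).
Proof. by move=> h g; rewrite act_neg// h. Qed.

Section local.
Variables (e : M) (ie : invariant e).

Lemma cup_local x y x' y' : cap x e = cap x' e -> cap y e = cap y' e ->
  cap (cup x y) e = cap (cup x' y') e.
Proof. by move=> h1 h2; rewrite !(pcapC MP _ e) !pcapUr// -!(pcapC MP _ e) h1 h2. Qed.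

Lemma cap_local x y x' y' : cap x e = cap x' e -> cap y e = cap y' e ->
  cap (cap x y) e = cap (cap x' y') e.
Proof.
have h (u w : M) : cap (cap u w) e = cap (cap u e) (cap w e).
  apply: mu_eq; boolean_inequality MP [:: u; w; e]
    [:: (-1 : R, sdiff (cap (cap u w) e) (cap (cap u e) (cap w e)))]; lra.
by move=> h1 h2; rewrite h h1 h2 -h.
Qed.

Lemma neg_local x x' : cap x e = cap x' e -> cap (neg x) e = cap (neg x') e.
Proof.
have h (u : M) : cap (neg u) e = cap (neg (cap u e)) e.
  apply: mu_eq; boolean_inequality MP [:: u; e]
    [:: (-1 : R, sdiff (cap (neg u) e) (cap (neg (cap u e)) e))]; lra.
by move=> h1; rewrite h h1 -h.
Qed.

Lemma act_local g x x' : cap x e = cap x' e -> cap (act g x) e = cap (act g x') e.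
Proof. by move=> h; rewrite -(ie g) -!act_cap// h. Qed.

(** Invariance of [e] enters through [act_local]: it makes the action compatible with cutting by
    [e], as the Boolean operations are for any [e]. *)
Lemma teval_local n (v w : 'I_n -> M) t : (forall i, cap (v i) e = cap (w i) e) ->
  cap (teval v t) e = cap (teval w t) e.
Proof.
move=> vw; elim: t => [i|f a IH]; first exact: vw.
have tE u : teval u (TApp f a) = _ := finterp_pmp (M := M) (fun i => teval u (a i)).
rewrite !{}tE.
case: f a IH => [|||||g] a IH //.
- exact: cup_local.
- exact: cap_local.
- exact: neg_local.
- exact: act_local.
Qed.

Lemma rfeval_local n (phi : formula sig n) (v w : 'I_n -> M) :
  (forall i, cap (v i) e = cap (w i) e) -> rfeval e phi v = rfeval e phi w.
Proof.
elim: phi v w => [{}n r|{}n s t|{}n P a|{}n p IHp q IHq|{}n r p IH|{}n p IH|{}n p IH] v w vw //=.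
- by congr mu; apply: cup_local; apply: cap_local; try apply: neg_local; exact: teval_local.
- by congr mu; exact: teval_local.
- by rewrite (IHp _ _ vw) (IHq _ _ vw).
- by rewrite (IH _ _ vw).
- congr (sup _); apply: eq_imagel => x _; apply: IH => i.
  by rewrite /extend; case: unlift.
- congr (inf _); apply: eq_imagel => x _; apply: IH => i.
  by rewrite /extend; case: unlift.
Qed.

End local.

Lemma feval_split e (ie : invariant e) n (phi : formula sig n) (v : 'I_n -> M) :
  feval phi v = rfeval e phi v + rfeval (neg e) phi v.
Proof.
have ine := invariant_neg ie.
(* A quantifier chooses independently on the two sides: by locality, the union of [x] inside [e] and
   [y] outside [e] imitates both choices. *)
have ext k (p : formula sig k.+1) (w : 'I_k -> M) x y : exists2 z,
    rfeval e p (extend z w) = rfeval e p (extend x w) &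
    rfeval (neg e) p (extend z w) = rfeval (neg e) p (extend y w).
  exists (cup (cap x e) (cap y (neg e))); apply: rfeval_local => // i;
      rewrite /extend; case: unlift => //; apply: mu_eq => //.
    boolean_inequality MP [:: x; y; e]
      [:: (-1 : R, sdiff (cap (cup (cap x e) (cap y (neg e))) e) (cap x e))]; lra.
  boolean_inequality MP [:: x; y; e]
    [:: (-1 : R, sdiff (cap (cup (cap x e) (cap y (neg e))) (neg e)) (cap y (neg e)))]; lra.
have le1 x : mu x <= 1 by rewrite -(mu_one MP) -[x](pcap_one MP) mu_cap_le.
have bnd e' k (p : formula sig k) (w : 'I_k -> M) : `|rfeval e' p w| <= fbound p.
  rewrite (le_trans (rfeval_bound _ _ _))// ler_piMr//.
  by rewrite (le_trans _ (feval_bound p w)).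
elim: phi v => [{}n r v|{}n s t v|{}n P a v|{}n p IHp q IHq v|{}n r p IH v|{}n p IH v|{}n p IH v];
  rewrite fevalE.
- by rewrite /= -mulrDr -mu_disjoint ?pcapN// pcupN// mu_one// mulr1.
- by rewrite mdist_mu// (mu_split MP _ e).
- by rewrite pinterp_pmp (mu_split MP _ e).
- by rewrite IHp IHq /=; ring.
- by rewrite IH /=; ring.
- under eq_fun do rewrite IH.
  by apply: (@sup_range_glue _ _ _ _ (fbound p)) => //; exact: carrier_nonempty.
- under eq_fun do rewrite IH.
  by apply: (@inf_range_glue _ _ _ _ (fbound p)) => //; exact: carrier_nonempty.
Qed.

End semantics.
End relativization.

(** * The system induced on an invariant element *)

Section cut.
Context {R : realType} {Gamma : groupType}.
Local Notation sig := (@pmp_sig R Gamma).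
Context (M : structure sig) (MP : models M (PMP R Gamma)).
Context (e : M) (ie : invariant e) (e0 : 0 < mu e).
Implicit Types x y z : M.

(** The carrier remains all of [M], and elements with the same trace on [e] are identified by the
    pseudometric. The function symbols, including complement and unit, thus keep their
    interpretation from [M]. *)
Definition cut_dist x y : R := (mu e)^-1 * mu (cap (sdiff x y) e).
Let cut_pred (P : psym sig) (a : 'I_(parity P) -> M) : R := (mu e)^-1 * mu (cap (a ord0) e).

Let i0 : 0 <= (mu e)^-1. Proof. by rewrite invr_ge0 ltW. Qed.


Let cut_xx x : cut_dist x x = 0.
Proof.
apply: le_anti; rewrite mulr_ge0 ?mu_ge0// andbT -(mulr0 (mu e)^-1) ler_wpM2l//.
by boolean_inequality MP [:: x; e] [:: (-1 : R, cap (sdiff x x) e)]; lra.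
Qed.

Let cut_C x y : cut_dist x y = cut_dist y x.
Proof. by rewrite /cut_dist /sdiff [cup (cap x _) _]pcupC. Qed.

Let cut_tri y x z : cut_dist x z <= cut_dist x y + cut_dist y z.
Proof.
rewrite /cut_dist -mulrDr ler_wpM2l//.
by boolean_inequality MP [:: x; y; z; e] [:: (1 : R, cap (sdiff x y) e);
  (1, cap (sdiff y z) e); (-1, cap (sdiff x z) e)]; lra.
Qed.

Let cut_le1 x : (mu e)^-1 * mu (cap x e) <= 1.
Proof. by rewrite -(mulVf (lt0r_neq0 e0)) ler_wpM2l// mu_cap_le. Qed.

Let mu_sdiff_cap x y : mu (sdiff (cap x e) (cap y e)) = mu (cap (sdiff x y) e).
Proof.
boolean_inequality MP [:: x; y; e] [:: (1 : R, sdiff (cap x e) (cap y e)); (-1, cap (sdiff x y) e)].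
boolean_inequality MP [:: x; y; e] [:: (-1 : R, sdiff (cap x e) (cap y e)); (1, cap (sdiff x y) e)].
by move=> h1 h2; apply: le_anti; apply/andP; split; lra.
Qed.

Let cut_complete : geo_complete cut_dist.
Proof.
move=> u C hu.
have hd x y : mdist (cap x e) (cap y e) = mu e * cut_dist x y.
  by rewrite mdist_mu// mu_sdiff_cap /cut_dist mulVKf// gt_eqF.
have hu' k : mdist (cap (u k) e) (cap (u k.+1) e) <= (mu e * C) * 2^-1 ^+ k.
  by rewrite hd -mulrA ler_wpM2l// ltW.
have [z [B hB]] := complete_geo (@carrier_complete _ _ M) hu'.
exists z, ((mu e)^-1 * B) => k; rewrite -mulrA ler_wpM2l//.
apply: le_trans (hB k); rewrite mdist_mu//.
by boolean_inequality MP [:: u k; z; e] [:: (1 : R, sdiff (cap (u k) e) z);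
  (-1, cap (sdiff (u k) z) e)]; lra.
Qed.

Let cut_diam x y : cut_dist x y <= diam sig. Proof. exact: cut_le1. Qed.

Let cup_lip x y x' y' : mu (cap (sdiff (cup x y) (cup x' y')) e) <=
  mu (cap (sdiff x x') e) + mu (cap (sdiff y y') e).
Proof.
by boolean_inequality MP [:: x; y; x'; y'; e] [:: (1 : R, cap (sdiff x x') e);
  (1, cap (sdiff y y') e); (-1, cap (sdiff (cup x y) (cup x' y')) e)]; lra.
Qed.

Let cap_lip x y x' y' : mu (cap (sdiff (cap x y) (cap x' y')) e) <=
  mu (cap (sdiff x x') e) + mu (cap (sdiff y y') e).
Proof.
by boolean_inequality MP [:: x; y; x'; y'; e] [:: (1 : R, cap (sdiff x x') e);
  (1, cap (sdiff y y') e); (-1, cap (sdiff (cap x y) (cap x' y')) e)]; lra.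
Qed.

Let neg_lip x x' : mu (cap (sdiff (neg x) (neg x')) e) <= mu (cap (sdiff x x') e).
Proof.
by boolean_inequality MP [:: x; x'; e] [:: (1 : R, cap (sdiff x x') e);
  (-1, cap (sdiff (neg x) (neg x')) e)]; lra.
Qed.

Let cut_fun_lip (f : fsym sig) (a b : 'I_(farity f) -> M) :
  cut_dist (finterp a) (finterp b) <= flip f * \sum_i cut_dist (a i) (b i).
Proof.
rewrite (finterp_pmp a) (finterp_pmp b) -mulr_sumr mul1r.
case: f a b => [|||||g] a b; rewrite /= ler_wpM2l// ?big_ord0 ?big_ord_recl ?big_ord0 ?addr0.
- rewrite (_ : lift ord0 ord0 = ord_max); [exact: cup_lip|exact: val_inj].
- rewrite (_ : lift ord0 ord0 = ord_max); [exact: cap_lip|exact: val_inj].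
- exact: neg_lip.
- by boolean_inequality MP [:: e] [:: (-1 : R, cap (sdiff (zero M) (zero M)) e)]; lra.
- by boolean_inequality MP [:: e] [:: (-1 : R, cap (sdiff (one M) (one M)) e)]; lra.
- rewrite -[leRHS](mu_act MP g) act_cap// ie.
  by rewrite /sdiff act_cup// !act_cap// !act_neg.
Qed.

Let cut_pred_lip (P : psym sig) (a b : 'I_(parity P) -> M) :
  `|cut_pred a - cut_pred b| <= plip P * \sum_i cut_dist (a i) (b i).
Proof.
rewrite mul1r big_ord_recl big_ord0 addr0 /cut_pred -mulrBr normrM ger0_norm//.
rewrite ler_wpM2l// ler_norml.
boolean_inequality MP [:: a ord0; b ord0; e] [:: (1 : R, cap (sdiff (a ord0) (b ord0)) e);
  (1, cap (a ord0) e); (-1, cap (b ord0) e)].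
boolean_inequality MP [:: a ord0; b ord0; e] [:: (1 : R, cap (sdiff (a ord0) (b ord0)) e);
  (-1, cap (a ord0) e); (1, cap (b ord0) e)].
by move=> h1 h2; apply/andP; split; lra.
Qed.

Let cut_pred_le (P : psym sig) (a : 'I_(parity P) -> M) : `|cut_pred a| <= pbound P.
Proof. by rewrite ger0_norm; [exact: cut_le1|rewrite mulr_ge0 ?mu_ge0]. Qed.

Definition cut_pre : prestructure sig :=
  Prestructure (carrier_nonempty M) cut_xx cut_C cut_tri cut_complete cut_diam
    cut_fun_lip cut_pred_lip cut_pred_le.

Definition cut : structure sig := quotient cut_pre.

Lemma pteval_cut n (v : 'I_n -> M) (t : term sig n) :
  pteval (X := cut_pre) v t = teval v t.
Proof. by elim: t => [//|f a IH] /=; congr finterp; apply/funext. Qed.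

Lemma teval_cut n (v : 'I_n -> M) (t : term sig n) :
  teval (M := cut) (qpi (X := cut_pre) \o v) t = qpi (X := cut_pre) (teval v t).
Proof. by rewrite teval_qpi pteval_cut. Qed.

Lemma feval_cut n (phi : formula sig n) (v : 'I_n -> M) :
  feval (M := cut) phi (qpi (X := cut_pre) \o v) = (mu e)^-1 * rfeval e phi v.
Proof.
have bnd k (p : formula sig k) (w : 'I_k -> M) x := rfeval_bound MP e p w.
have V0 := carrier_nonempty M.
elim: phi v => [{}n r v|{}n s t v|{}n P a v|{}n p IHp q IHq v|{}n r p IH v|{}n p IH v|{}n p IH v];
  rewrite fevalE.
- by rewrite /= mulrCA mulVf ?mulr1// gt_eqF.
- by rewrite !teval_cut mdist_qpi.
- rewrite (_ : (fun i => _) = fun i => qpi (X := cut_pre) (teval v (a i))); last first.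
    by apply/funext => i; rewrite teval_cut.
  by rewrite pinterp_qpi.
- by rewrite IHp IHq mulrDr.
- by rewrite IH mulrCA.
- rewrite range_quotient -(@sup_rangeZ _ _ _ (fbound p * mu e))//; last first.
    by move=> x; exact: rfeval_bound.
  by congr (sup _); apply: eq_imagel => x _ /=; rewrite extend_comp IH.
- rewrite range_quotient -(@inf_rangeZ _ _ _ (fbound p * mu e))//; last first.
    by move=> x; exact: rfeval_bound.
  by congr (inf _); apply: eq_imagel => x _ /=; rewrite extend_comp IH.
Qed.

Let qpi_w n (w : 'I_n -> cut) : exists v : 'I_n -> M, w = qpi (X := cut_pre) \o v.
Proof. by exists (fun i => qrepr (w i)); apply/funext => i; rewrite /= qreprK. Qed.

Let cut_teq n (s t : term sig n) (w : 'I_0 -> cut) :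
  PMP R Gamma (ax_teq s t) -> 0 <= feval (ax_teq s t) w.
Proof.
move=> h; apply: (iffRL (ax_teqP s t w)) => w'.
have [v ->] := qpi_w w'; rewrite !teval_cut; congr qpi.
exact: (iffLR (ax_teqP s t (fun=> e))) (MP h _) v.
Qed.

Let rfevalE n (v : 'I_n -> M) :
  (forall r, rfeval e (FConst r) v = r * mu e) *
  (forall t, rfeval e (fmu t) v = mu (cap (teval v t) e)) *
  (forall s t, rfeval e (FDist s t) v = mu (cap (sdiff (teval v s) (teval v t)) e)) *
  (forall p q, rfeval e (FAdd p q) v = rfeval e p v + rfeval e q v).
Proof. by []. Qed.

(** Equations between terms are inherited from [M], since terms are evaluated there before passing
    to the quotient. The remaining axioms are equalities of formulas and reduce to equalities of
    their relativizations; for the action these follow from invariance of [e]. *)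
Lemma models_cut : models cut (PMP R Gamma).
Proof.
move=> phi [[[Hb|Hm]|[g _ He]]|Ha] w;
  have E n (p q : formula sig n) : (forall v : 'I_n -> M,
    rfeval e p v = rfeval e q v) -> ax_eq p q `<=` [set phi | 0 <= feval phi w]
  by move=> h phi' [->|->]; apply/ax_geP => w'; have [v ->] := qpi_w w'; rewrite !feval_cut h.
- by case: phi / Hb (Hb) => Hb; apply: cut_teq; left; left; left.
- move: Hm => [[|]|]; apply: E => v; rewrite !rfevalE.
  + by rewrite pmp_tevalE [cap _ e]pcapC// pcap_one// mul1r.
  + rewrite !pmp_tevalE !(pcapC MP _ e) pcapUr// -(mu_modular MP (cap e _)).
    congr (_ + mu _); apply: (mu_eq MP).
    set x := teval _ _; set y := teval _ _.
    boolean_inequality MP [:: x; y; e]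
      [:: (-1 : R, sdiff (cap e (cap x y)) (cap (cap e x) (cap e y)))]; lra.
  + by rewrite teval_tsymdiff.
- case: He => [[H5|]|].
  + have : PMP R Gamma phi by left; right; exists g => //; left; left.
    by case: H5 => [[[[->|->]|->]|->]|->] hP; exact: cut_teq.
  + apply: E => v; rewrite !rfevalE pmp_tevalE -[RHS](mu_act MP g) act_cap//.
    by rewrite ie.
  + apply: E => v; rewrite !rfevalE !pmp_tevalE -[RHS](mu_act MP g) act_cap// ie.
    by rewrite /sdiff act_cup// !act_cap// !act_neg.
- have : PMP R Gamma phi by right.
  by case: Ha => [[g [h ->]]|->] hP; exact: cut_teq.
Qed.

Lemma rfeval_type n (v : 'I_n -> M) :
  aff_types (PMP R Gamma) (fun phi => (mu e)^-1 * rfeval e phi v).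
Proof.
exists cut; split; first exact: models_cut.
by exists (qpi (X := cut_pre) \o v); apply/funext => phi; rewrite /aff_type feval_cut.
Qed.

End cut.

(** * Extremal models *)

Section measure_inequalities.
Context {R : realType} {Gamma : groupType}.
Context (M : structure (@pmp_sig R Gamma)) (MP : models M (PMP R Gamma)).
Implicit Types x y z : M.

Lemma mu_le1 x : mu x <= 1.
Proof. by rewrite -(mu_one MP) -[x](pcap_one MP) mu_cap_le. Qed.

Lemma mdist_cup x y : mdist x y = 2 * mu (cup x y) - mu x - mu y.
Proof.
rewrite mdist_mu//.
boolean_inequality MP [:: x; y] [:: (1 : R, sdiff x y); (-2, cup x y); (1, x); (1, y)].
boolean_inequality MP [:: x; y] [:: (-1 : R, sdiff x y); (2, cup x y); (-1, x); (-1, y)].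
by move=> h1 h2; apply: le_anti; apply/andP; split; lra.
Qed.

Lemma mu_dist x y : `|mu x - mu y| <= mdist x y.
Proof.
rewrite mdist_mu// ler_norml.
boolean_inequality MP [:: x; y] [:: (1 : R, sdiff x y); (-1, x); (1, y)].
boolean_inequality MP [:: x; y] [:: (1 : R, sdiff x y); (1, x); (-1, y)].
by move=> h1 h2; apply/andP; split; lra.
Qed.

(** Estimating union and intersection together costs no factor 2. This sharp form is what makes the
    function [G] of [ergodic_term_measure] supermodular. *)
Lemma mu_sdiff_lattice x y x' y' :
  mu (sdiff (cup x y) (cup x' y')) + mu (sdiff (cap x y) (cap x' y')) <=
  mu (sdiff x x') + mu (sdiff y y').
Proof.
boolean_inequality MP [:: x; y; x'; y'] [:: (1 : R, sdiff x x'); (1, sdiff y y');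
  (-1, sdiff (cup x y) (cup x' y')); (-1, sdiff (cap x y) (cap x' y'))].
lra.
Qed.

Lemma mu_sdiff_tri x y z : mu (sdiff x z) <= mu (sdiff x y) + mu (sdiff y z).
Proof. by rewrite -!mdist_mu// metric_triangle. Qed.

End measure_inequalities.

(** * Invariant maximizers and the extremality of ergodic systems *)

Section ergodic_models.
Context {R : realType} {Gamma : groupType}.
Local Notation sig := (@pmp_sig R Gamma).
Local Notation PMP := (PMP R Gamma).
Context (M : structure sig) (MP : models M PMP).
Implicit Types x y h : M.

Lemma finterp_act g x : @finterp _ _ M (Act g : fsym sig) (fun=> x) = act g x.
Proof. by congr finterp; apply/funext => -[[|//] i]. Qed.

Section supermodular.
Variables (G : M -> R) (K : R).
Hypothesis GK : forall x y, `|G x - G y| <= K * mdist x y.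
Hypothesis Gsup : forall x y, G x + G y <= G (cup x y) + G (cap x y).
Hypothesis Gact : forall g x, G x <= G (act g x).

Let beta := sup (range G).

Let V0 : [set: M] !=set0. Proof. by exists (zero M). Qed.
Let K0 : 0 <= K.
Proof.
have := le_trans (normr_ge0 _) (GK (one M) (zero M)).
rewrite pmulr_lge0// mdist_gt0; apply/eqP => h.
by have := mu_one MP; rewrite h mu_zero// => /esym/eqP; rewrite oner_eq0.
Qed.
Let GB x : `|G x| <= `|G (zero M)| + K.
Proof.
have h : `|G x - G (zero M)| <= K.
  by apply: le_trans (GK _ _) _; rewrite ler_piMr// mdist_le_diam.
by rewrite -[G x](subrK (G (zero M))) (le_trans (ler_normD _ _))// addrC lerD.
Qed.
Let Gbeta x : G x <= beta. Proof. exact: (le_sup_range GB). Qed.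

(* Among the near maximizers of [G], those of nearly maximal measure are close
   to each other, because their unions are again near maximizers. *)
Lemma supermodular_maximizer : exists2 h, G h = beta & invariant h.
Proof.
pose S e := [set mu x | x in [set x | beta - e < G x]].
have Sle1 e : ubound (S e) 1 by move=> _ [x _ <-]; exact: (mu_le1 MP).
have Sub e : has_ubound (S e) by exists 1.
have S0 e : 0 < e -> S e !=set0.
  by move=> e0; have [x hx] := sup_range_near V0 GB e0; exists (mu x), x.
pose Ssup := [set sup (S e) | e in [set e : R | 0 < e]].
have Ssup0 : Ssup !=set0 by exists (sup (S 1)), 1 => //=.
have sup_ge0 e : 0 < e -> 0 <= sup (S e).
  move=> e0; have [_ [x hx _]] := S0 _ e0; apply: le_trans (mu_ge0 MP x) _.
  by apply: ub_le_sup => //; exists x.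
have Slb : has_lbound Ssup by exists 0 => _ [e e0 <-]; exact: sup_ge0.
(* The limit, as [e] tends to 0, of the largest measure attained by [e]-near maximizers of [G]. *)
pose gamma := inf Ssup.
have gammaS e : 0 < e -> gamma <= sup (S e) by move=> e0; apply: ge_inf => //; exists e.
pose A e := [set x | beta - e < G x /\ gamma - e < mu x].
have A0 e : 0 < e -> A e !=set0.
  move=> e0; have [] := sup_adherent e0 (conj (S0 e e0) (Sub e)).
  move=> _ [x hx <-] hmu; exists x; split=> //.
  by apply: le_lt_trans hmu; rewrite lerD2r gammaS.
have Amono e e' : e <= e' -> A e `<=` A e'.
  by move=> ee x [h1 h2]; split; [apply: le_lt_trans h1|apply: le_lt_trans h2]; rewrite lerB.
pose F := filter_from [set e : R | 0 < e] A.
have FF : ProperFilter F.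
  apply: filter_from_proper; last by move=> e; exact: A0.
  apply: filter_from_filter; first by exists 1 => /=.
  move=> e e' /= e0 e0'; exists (Num.min e e'); first by rewrite /= lt_min e0.
  by move=> x hx; split; apply: Amono hx; rewrite ge_min lexx ?orbT.
have Adiam eta : 0 < eta -> exists2 e, 0 < e & forall x y, A e x -> A e y -> mdist x y < eta.
  move=> eta0; have e4 : 0 < eta / 4 by rewrite divr_gt0.
  have [_ [e0 /= e00 <-] he0] := inf_adherent e4 (conj Ssup0 Slb).
  (* The bound [e0 / 2] makes the union of two elements an [e0]-near maximizer, of measure below
     [gamma + eta / 4]. As both measures exceed [gamma - eta / 4], the distance
     [2 * mu (cup x y) - mu x - mu y] is below [eta]. *)
  exists (Num.min (e0 / 2) (eta / 4)); first by rewrite lt_min e4 divr_gt0.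
  move=> x y [gx mx] [gy my].
  have m1 : Num.min (e0 / 2) (eta / 4) <= e0 / 2 by rewrite ge_min lexx.
  have m2 : Num.min (e0 / 2) (eta / 4) <= eta / 4 by rewrite ge_min lexx orbT.
  have hu : mu (cup x y) <= sup (S e0).
    apply: ub_le_sup => //; exists (cup x y) => //=.
    by have := Gsup x y; have := Gbeta (cap x y); lra.
  by rewrite (mdist_cup MP); rewrite -/gamma in he0; lra.
have cF : cauchy F.
  apply: cauchy_exP => eta eta0; have [e e0 he] := Adiam _ eta0.
  have [x Ax] := A0 _ e0; exists x, e => // y Ay.
  by rewrite ballEmdist /=; exact: he.
have [h Fh] := @carrier_complete _ _ M F FF cF.
have near e : 0 < e -> exists2 x, A e x & mdist h x < e.
  move=> e0; have FA : F (A e) by exists e.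
  have FB : F (ball h e) by apply: Fh; exact: nbhsx_ballx.
  by have [x [Ax]] := filter_ex (filterI FA FB); rewrite ballEmdist; exists x.
have Gh : G h = beta.
  apply: le_anti; rewrite Gbeta /=; apply/ler_addgt0Pl => e e0.
  have K1 : 0 < 1 + K by rewrite ltr_wpDr.
  have [x [gx _] hx] := near (e / (1 + K)) (divr_gt0 e0 K1).
  have h1 := GK h x; have h2 : K * mdist h x <= K * (e / (1 + K)) by rewrite ler_wpM2l// ltW.
  have h3 : (1 + K) * (e / (1 + K)) = e by rewrite mulrC divfK// gt_eqF.
  move: h1; rewrite ler_distl => /andP[h1 _]; lra.
exists h => // g.
have gh : gamma <= mu h.
  apply/ler_addgt0Pl => e e0; have [x [_ mx] hx] := near (e / 2) (divr_gt0 e0 (ltr0Sn _ 1)).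
  by have := mu_dist MP h x; rewrite ler_distl => /andP[h1 _]; lra.
(* The union of [h] and its translate again maximizes [G], so it cannot be larger in measure than
   [h]. Since the translate has the measure of [h], the two coincide. *)
have hu : mu (cup h (act g h)) <= gamma.
  apply: lb_le_inf => // _ [e /= e0 <-]; apply: ub_le_sup => //.
  exists (cup h (act g h)) => //=.
  by have := Gsup h (act g h); have := Gbeta (cap h (act g h)); have := Gact g h; lra.
apply/esym/mdist_positivity/le_anti; rewrite mdist_ge0 andbT (mdist_cup MP) mu_act//; lra.
Qed.

Lemma ergodic_supermodular_le0 : ergodic M ->
  G (zero M) <= 0 -> G (one M) <= 0 -> forall x, G x <= 0.
Proof.
move=> erg G0 G1 x; apply: le_trans (Gbeta x) _.
have [h <- ih] := supermodular_maximizer.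
have hfix g : @finterp _ _ M (Act g : fsym sig) (fun=> h) = h by rewrite finterp_act ih.
by have [->|->] := erg h hfix.
Qed.

End supermodular.

(** The difference [lam] is a signed measure, invariant under the action but defined only on terms.
    Its Lipschitz extension [G] to [M] is supermodular and nonpositive at [zero] and [one]. By
    ergodicity it is nonpositive everywhere, which forces [lam] to vanish. *)
Lemma ergodic_term_measure n (a : 'I_n -> M) (x y : formula sig n -> R^o) (t : R) :
  ergodic M -> aff_types PMP x -> aff_types PMP y -> 0 < t -> t < 1 ->
  (forall phi, feval phi a = t * x phi + (1 - t) * y phi) ->
  forall s, x (fmu s) = mu (teval a s).
Proof.
move=> erg [Q [QP [b ->]]] [N [NP [c ->]]] t0 t1 hxy.
pose lam (s : term sig n) := mu (teval b s) - mu (teval a s).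
(* A Lipschitz constant of [lam] for the metric of [M]: the part [x] has weight [t], so its measure
   is at most [t^-1] times that of [a], and the measure of [a] itself contributes 1. *)
pose K := t^-1 + 1.
have le_mu s : mu (teval b s) <= t^-1 * mu (teval a s).
  have := hxy (fmu s); rewrite /aff_type !feval_fmu => ->.
  rewrite mulrDr mulKf ?gt_eqF// lerDl mulr_ge0 ?invr_ge0 ?(ltW t0)//.
  by rewrite mulr_ge0 ?mu_ge0// subr_ge0 ltW.
have lamK s s' : lam s - lam s' <= K * mu (sdiff (teval a s) (teval a s')).
  have h := le_mu (tsymdiff s s'); rewrite !teval_tsymdiff in h.
  rewrite /lam /K mulrDl mul1r; move: h.
  set u := teval b s; set u' := teval b s'; set w := teval a s; set w' := teval a s'.
  have := mu_dist QP u u'; have := mu_dist MP w w'; rewrite !mdist_mu// !ler_distl.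
  by move=> /andP[h1 _] /andP[_ h2] h; clear -h h1 h2; lra.
have K0 : 0 <= K by rewrite addr_ge0// invr_ge0 ltW.
(* The supremum over [s] is McShane's extension, the least [K]-Lipschitz function on [M] that is at
   least [lam] at the values of terms. *)
pose Gs m s := lam s - K * mu (sdiff (teval a s) m).
have GsB m s : `|Gs m s| <= 1 + K.
  have h1 := mu_ge0 QP (teval b s); have h2 := mu_ge0 MP (teval a s).
  have h3 := mu_le1 MP (teval a s); have h4 := mu_ge0 MP (sdiff (teval a s) m).
  have h5 := mu_le1 QP (teval b s).
  have h6 : K * mu (sdiff (teval a s) m) <= K by rewrite ler_piMr// (mu_le1 MP).
  have h7 : 0 <= K * mu (sdiff (teval a s) m) by rewrite mulr_ge0.
  by rewrite ler_norml /Gs /lam; apply/andP; split; lra.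
have T0 : [set: term sig n] !=set0 by exists (@tzero R Gamma n).
pose G m := sup (range (Gs m)).
have Gge m s : Gs m s <= G m := le_sup_range (GsB m) s.
have GLip m m' : G m <= G m' + K * mdist m m'.
  apply: sup_range_le => // s; apply: le_trans (lerD (Gge m' s) (lexx _)).
  rewrite /Gs mdist_mu//; set u := teval a s.
  have hd : mu (sdiff u m') <= mu (sdiff m m') + mu (sdiff u m).
    by rewrite addrC mu_sdiff_tri.
  by have := ler_wpM2l K0 hd; rewrite mulrDr; lra.
have Gle0 : forall m, G m <= 0.
  apply: (@ergodic_supermodular_le0 G K) => //.
  - move=> m m'; rewrite ler_distl lerBlDr GLip andbT.
    by rewrite metric_sym GLip.
  - move=> m m'; apply/ler_addgt0Pl => e e0; have e2 : 0 < e / 2 by rewrite divr_gt0.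
    have [s hs] := sup_range_near T0 (GsB m) e2.
    have [s' hs'] := sup_range_near T0 (GsB m') e2.
    have h1 := Gge (cup m m') (tcup s s'); have h2 := Gge (cap m m') (tcap s s').
    have hl : lam (tcup s s') + lam (tcap s s') = lam s + lam s'.
      rewrite /lam !pmp_tevalE.
      have := mu_modular MP (teval a s) (teval a s').
      by have := mu_modular QP (teval b s) (teval b s'); lra.
    have hd : mu (sdiff (teval a (tcup s s')) (cup m m')) +
        mu (sdiff (teval a (tcap s s')) (cap m m')) <=
        mu (sdiff (teval a s) m) + mu (sdiff (teval a s') m').
      by rewrite !pmp_tevalE; exact: (mu_sdiff_lattice MP).
    have := ler_wpM2l K0 hd; rewrite !mulrDr => hK.
    rewrite -/(G m) in hs; rewrite -/(G m') in hs'; rewrite /Gs in hs hs' h1 h2.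
    lra.
  - move=> g m; apply: sup_range_le => // s; apply: le_trans (Gge _ (tact g s)).
    rewrite /Gs /lam !pmp_tevalE !mu_act// -(act_sdiff MP) mu_act//.
  - apply: sup_range_le => // s; have := lamK s (@tzero R Gamma n).
    rewrite /Gs !pmp_tevalE {2}/lam !pmp_tevalE !mu_zero//; lra.
  - apply: sup_range_le => // s; have := lamK s (@tone R Gamma n).
    rewrite /Gs !pmp_tevalE {2}/lam !pmp_tevalE !mu_one//; lra.
have lam_le0 s : lam s <= 0.
  apply: le_trans (Gle0 (teval a s)); apply: le_trans (Gge _ s).
  rewrite /Gs -mdist_mu// mdistxx; lra.
move=> s; rewrite /aff_type feval_fmu; apply/eqP; rewrite -subr_eq0.
(* The values of [lam] at a term and at its complement add up to 0, so two nonpositive values are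
   both 0. *)
have h1 := lam_le0 s; have h2 := lam_le0 (tneg s).
apply/eqP/le_anti; rewrite h1 /=; move: h2; rewrite /lam !pmp_tevalE.
have := mu_modular MP (teval a s) (neg (teval a s)).
have := mu_modular QP (teval b s) (neg (teval b s)).
rewrite !pcupN// !pcapN// !mu_one// !mu_zero//; lra.
Qed.

(** The induction runs over all tuples and decompositions at once, because quantifiers lengthen the
    tuple. An approximate witness yields only an inequality, in the same direction for both parts.
    Two numbers on the same side of their proper average are equal to it, and this is [avg_eq]. *)
Lemma ergodic_component n (phi : formula sig n) (a : 'I_n -> M)
    (x y : formula sig n -> R^o) (t : R) :
  ergodic M -> aff_types PMP x -> aff_types PMP y -> 0 < t -> t < 1 ->
  (forall phi, feval phi a = t * x phi + (1 - t) * y phi) ->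
  x phi = feval phi a.
Proof.
move=> erg.
have avg_eq (f u v s : R) : 0 < s -> s < 1 -> f = s * u + (1 - s) * v ->
    (f <= u /\ f <= v) \/ (u <= f /\ v <= f) -> u = f.
  move=> s0 s1 hf huv; apply/eqP; rewrite -subr_eq0; apply/eqP.
  have h : s * (u - f) + (1 - s) * (v - f) = 0 by rewrite hf; ring.
  have s1' : 0 < 1 - s by rewrite subr_gt0.
  have : s * (u - f) = 0.
    case: huv => -[h1 h2]; apply: le_anti; apply/andP; split.
    - have : 0 <= (1 - s) * (v - f) by rewrite mulr_ge0 ?subr_ge0 ?(ltW s1).
      lra.
    - by rewrite mulr_ge0 ?subr_ge0 ?(ltW s0).
    - by rewrite mulr_ge0_le0 ?subr_le0 ?(ltW s0).
    - have : (1 - s) * (v - f) <= 0 by rewrite mulr_ge0_le0 ?subr_le0 ?subr_ge0 ?(ltW s1).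
      lra.
  by move/eqP; rewrite mulf_eq0 gt_eqF//= => /eqP.
have swap k (p : formula sig k) (c : 'I_k -> M) u v (s : R) :
    feval p c = s * u p + (1 - s) * v p -> feval p c = (1 - s) * v p + (1 - (1 - s)) * u p.
  by move=> ->; ring.
elim: phi a x y t => [{}n r|{}n s t'|{}n P b|{}n p IHp q IHq|{}n r p IH|{}n p IH|{}n p IH] a x y t Ax Ay t0 t1 hxy.
- by case: Ax => [Q [QP [w ->]]].
- have := ergodic_term_measure erg Ax Ay t0 t1 hxy (tsymdiff s t').
  rewrite teval_tsymdiff -mdist_mu// -[feval _ a]/(mdist (teval a s) (teval a t')) => <-.
  case: (Ax) => [Q [QP [w ->]]].
  by rewrite /aff_type fevalE feval_fmu teval_tsymdiff mdist_mu.
- have := ergodic_term_measure erg Ax Ay t0 t1 hxy (b ord0).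
  rewrite -[feval _ a]/(pinterp (fun i => teval a (b i))) pinterp_pmp => <-.
  case: (Ax) => [Q [QP [w ->]]].
  by rewrite /aff_type fevalE feval_fmu pinterp_pmp.
- rewrite fevalE -(IHp _ _ _ _ Ax Ay t0 t1 hxy) -(IHq _ _ _ _ Ax Ay t0 t1 hxy).
  by case: (Ax) => [Q [QP [w ->]]].
- rewrite fevalE -(IH _ _ _ _ Ax Ay t0 t1 hxy).
  by case: (Ax) => [Q [QP [w ->]]].
- have key (x' y' : formula sig n -> R^o) (t' : R) : aff_types PMP x' -> aff_types PMP y' -> 0 < t' -> t' < 1 ->
      (forall phi, feval phi a = t' * x' phi + (1 - t') * y' phi) ->
      feval (FSup p) a <= x' (FSup p).
    move=> Ax' Ay' t0' t1' h; apply/ler_addgt0Pl => e e0.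
    have [m hm] := sup_range_near (carrier_nonempty M) (fun m => feval_bound p (extend m a)) e0.
    have Am : aff_types PMP (aff_type (extend m a)) by exists M; split=> //; exists (extend m a).
    have [|x2 [y2 [Ax2 Ay2 ex _ hr]]] := amalgamation Ax' Ay' Am (ltW t0') (ltW t1').
      by move=> q; rewrite /aff_type feval_fwk h.
    have := IH _ _ _ _ Ax2 Ay2 t0' t1' hr.
    case: Ax2 ex => [Q [QP [w ->]]] ex hw.
    rewrite -ex /aff_type feval_fren fevalE.
    have := le_sup_range (fun d => feval_bound p (extend d (w \o lift ord0))) (w ord0).
    rewrite -extend_eta -[feval p w]/(aff_type w p) hw => h2.
    by rewrite fevalE; move: hm h2; lra.
  apply: (avg_eq _ _ _ _ t0 t1 (hxy _)); left; split; first exact: key Ax Ay t0 t1 hxy.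
  apply: (key y x (1 - t)) => //; rewrite ?subr_gt0 ?gtrBl//.
  by move=> q; exact: swap.
- have key (x' y' : formula sig n -> R^o) (t' : R) : aff_types PMP x' -> aff_types PMP y' -> 0 < t' -> t' < 1 ->
      (forall phi, feval phi a = t' * x' phi + (1 - t') * y' phi) ->
      x' (FInf p) <= feval (FInf p) a.
    move=> Ax' Ay' t0' t1' h; apply/ler_addgt0Pl => e e0.
    have [m hm] := inf_range_near (carrier_nonempty M) (fun m => feval_bound p (extend m a)) e0.
    have Am : aff_types PMP (aff_type (extend m a)) by exists M; split=> //; exists (extend m a).
    have [|x2 [y2 [Ax2 Ay2 ex _ hr]]] := amalgamation Ax' Ay' Am (ltW t0') (ltW t1').
      by move=> q; rewrite /aff_type feval_fwk h.
    have := IH _ _ _ _ Ax2 Ay2 t0' t1' hr.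
    case: Ax2 ex => [Q [QP [w ->]]] ex hw.
    rewrite -ex /aff_type feval_fren fevalE.
    have := inf_range_le (fun d => feval_bound p (extend d (w \o lift ord0))) (w ord0).
    rewrite -extend_eta -[feval p w]/(aff_type w p) hw => h2.
    by rewrite fevalE; move: hm h2; lra.
  apply: (avg_eq _ _ _ _ t0 t1 (hxy _)); right; split; first exact: key Ax Ay t0 t1 hxy.
  apply: (key y x (1 - t)) => //; rewrite ?subr_gt0 ?gtrBl//.
  by move=> q; exact: swap.
Qed.

Lemma ergodic_extremal : ergodic M -> extremal PMP M.
Proof.
move=> erg n a; split; first by exists M; split=> //; exists a.
move=> x y t Ax Ay t0 t1 hxy.
have h phi : feval phi a = t * x phi + (1 - t) * y phi.
  by rewrite -[LHS]/(aff_type a phi) hxy.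
split; apply/funext => phi; first exact: (ergodic_component phi erg Ax Ay t0 t1 h).
apply: (ergodic_component (t := 1 - t) phi erg Ay Ax); rewrite ?subr_gt0 ?gtrBl// => q.
by rewrite h; ring.
Qed.

Lemma extremal_ergodic : extremal PMP M -> ergodic M.
Proof.
move=> ext a ha; have ia : invariant a by move=> g; rewrite -finterp_act.
have ina := invariant_neg MP ia.
have muN : mu (neg a) = 1 - mu a.
  by have := mu_modular MP a (neg a); rewrite pcupN// pcapN// mu_one// mu_zero//; lra.
have [a0|a0] := eqVneq (mu a) 0.
  left; rewrite -/(zero M); apply: (mu_eq MP); rewrite -[leRHS]a0.
  by boolean_inequality MP [:: a] [:: (1 : R, a); (-1, sdiff a (zero M))]; lra.
have [a1|a1] := eqVneq (mu a) 1.
  right; rewrite -/(one M); apply: (mu_eq MP); have := muN; rewrite a1 subrr => <-.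
  by boolean_inequality MP [:: a] [:: (1 : R, neg a); (-1, sdiff a (one M))]; lra.
have {}a0 : 0 < mu a by rewrite lt_neqAle eq_sym a0 mu_ge0.
have {}a1 : mu a < 1 by rewrite lt_neqAle a1 (mu_le1 MP).
have n0 : 0 < mu (neg a) by rewrite muN subr_gt0.
(* The tuple is [a] itself. In the system induced on [a] it has measure 1, so extremality would give
   [mu a = 1]. *)
have [_ /(_ _ _ (mu a) (rfeval_type MP ia a0 (fun _ : 'I_1 => a))
  (rfeval_type MP ina n0 (fun _ : 'I_1 => a)) a0 a1)[]] := ext 1%N (fun=> a).
  apply/funext => phi; rewrite -muN.
  rewrite -[RHS]/(mu a * ((mu a)^-1 * _) + mu (neg a) * ((mu (neg a))^-1 * _)).
  by rewrite !mulVKf ?gt_eqF// -feval_split.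
move=> /(congr1 (fun f => f (fmu (TVar ord0)))).
rewrite /aff_type feval_fmu /= pcapxx// mulVf ?gt_eqF// => /esym/eqP.
by rewrite lt_eqF.
Qed.

End ergodic_models.

(** * The cone over the types is a lattice *)

Lemma scale_regularE {R : pzRingType} (a : R) (b : R^o) : a *: b = a * b.
Proof. by []. Qed.

Ltac vecE := rewrite /= ?fctE /= ?scale_regularE.
Ltac vec := apply: injective_projections; [apply/funext => ?; vecE; ring|vecE; ring].

(** * Meets in convex cones *)

Section meet_cones.
Context {R : realType} (I : Type).
Local Notation W := ((I -> R^o) * R^o)%type.
Implicit Types u v w z : W.

(** Elements of [C - C] are translated into [C], where meets are available, and joins come from
    [u + v] minus the meet. *)
Lemma meet_cone_lattice (C : set W) :
  (forall u v, C u -> C v -> C (u + v)) ->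
  (forall u v, C u -> C v -> exists w, [/\ C w, C (u - w), C (v - w) &
     forall z, C z -> C (u - z) -> C (v - z) -> C (w - z)]) ->
  lattice_cone C.
Proof.
move=> CD meet.
pose E := [set u - v | u in C & v in C].
have EB u v : E u -> E v -> E (u - v).
  move=> [u1 Cu1 [u2 Cu2 <-]] [v1 Cv1 [v2 Cv2 <-]].
  exists (u1 + v2); first exact: CD.
  by exists (u2 + v1); [exact: CD|vec].
have inf_ex u v : E u -> E v -> exists2 w, E w & [/\ C (u - w), C (v - w) &
    forall z, E z -> C (u - z) -> C (v - z) -> C (w - z)].
  move=> [u1 Cu1 [u2 Cu2 <-]] [v1 Cv1 [v2 Cv2 <-]].
  have [m [Cm Cum Cvm mmax]] := meet _ _ (CD _ _ Cu1 Cv2) (CD _ _ Cv1 Cu2).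
  exists (m - (u2 + v2)); first by exists m => //; exists (u2 + v2) => //; exact: CD.
  split.
  - by have -> : u1 - u2 - (m - (u2 + v2)) = u1 + v2 - m by vec.
  - by have -> : v1 - v2 - (m - (u2 + v2)) = v1 + u2 - m by vec.
  move=> _ [z1 Cz1 [z2 Cz2 <-]] uz vz.
  (* The competitor [z1 - z2] may leave [C] even after translation, while [m] is the greatest lower
     bound only among elements of [C]. Adding [z2] to everything brings it back, and [m' - z2] is
     then compared with [m]. *)
  have [m' [Cm' Cum' Cvm' m'max]] :=
    meet _ _ (CD _ _ (CD _ _ Cu1 Cv2) Cz2) (CD _ _ (CD _ _ Cv1 Cu2) Cz2).
  have h1 : C (m' - (z1 + (u2 + v2))).
    apply: m'max; first exact: CD Cz1 (CD _ _ Cu2 Cv2).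
    - by have -> : u1 + v2 + z2 - (z1 + (u2 + v2)) = u1 - u2 - (z1 - z2) by vec.
    - by have -> : v1 + u2 + z2 - (z1 + (u2 + v2)) = v1 - v2 - (z1 - z2) by vec.
  have h2 : C (m' - z2) by apply: m'max; rewrite ?addrK //; exact: CD.
  have h3 : C (m - (m' - z2)).
    apply: mmax => //.
    - by have -> : u1 + v2 - (m' - z2) = u1 + v2 + z2 - m' by vec.
    - by have -> : v1 + u2 - (m' - z2) = v1 + u2 + z2 - m' by vec.
  have -> : m - (u2 + v2) - (z1 - z2) = m - (m' - z2) + (m' - (z1 + (u2 + v2))) by vec.
  exact: CD.
move=> u v Eu Ev; have [w Ew [uw vw wmax]] := inf_ex u v Eu Ev.
split; last by exists w.
have Ez z : E z -> E (u + v - z).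
  move=> Ez; have -> : u + v - z = u - (z - v) by vec.
  exact: (EB _ _ Eu (EB _ _ Ez Ev)).
exists (u + v - w); first exact: Ez.
split.
- by have -> : u + v - w - u = v - w by vec.
- by have -> : u + v - w - v = u - w by vec.
move=> z /Ez Ey uz vz.
have -> : z - (u + v - w) = w - (u + v - z) by vec.
apply: wmax => //.
- by have -> : u - (u + v - z) = z - v by vec.
- by have -> : v - (u + v - z) = z - u by vec.
Qed.

(** Let [w] be a lower bound of maximal mass and [z] another one. Refining
    [(u - w) + (v - z) = (u - z) + (v - w)] isolates a common part [p2] of [u - w] and [v - w]. It
    vanishes, since [w + p2] would otherwise have larger mass, and what remains of the refinement is
    [w - z = q1]. *)
Lemma interpolation_meet (C : set W) :
  (forall u v, C u -> C v -> C (u + v)) -> C 0 ->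
  (forall u, C u -> 0 <= u.2) -> (forall u, C u -> u.2 = 0 -> u = 0) ->
  (forall a b c d, C a -> C b -> C c -> C d -> a + d = b + c ->
    exists p1 p2 q1 q2, [/\ C p1, C p2, C q1 & C q2] /\
      [/\ a = p1 + p2, d = q1 + q2, b = p1 + q1 & c = p2 + q2]) ->
  (forall u v, C u -> C v -> exists w, [/\ C w, C (u - w), C (v - w) &
     forall z, C z -> C (u - z) -> C (v - z) -> z.2 <= w.2]) ->
  forall u v, C u -> C v -> exists w, [/\ C w, C (u - w), C (v - w) &
     forall z, C z -> C (u - z) -> C (v - z) -> C (w - z)].
Proof.
move=> CD C0 Cge0 Ceq0 rdp maxi u v Cu Cv.
have [w [Cw uw vw wmax]] := maxi u v Cu Cv; exists w; split=> // z Cz uz vz.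
have [|p1 [p2 [q1 [q2 [[Cp1 Cp2 Cq1 Cq2] [h1 h2 h3 h4]]]]]] := rdp _ _ _ _ uw uz vw vz.
  by vec.
have p20 : p2 = 0.
  apply: Ceq0 => //; apply: le_anti; rewrite Cge0// andbT.
  have := wmax (w + p2); rewrite -[leRHS]addr0 [leLHS]/= lerD2l; apply.
  - exact: CD.
  - rewrite [X in C X](_ : _ = u - w - p2); last by vec.
    by rewrite h1 addrK.
  - rewrite [X in C X](_ : _ = v - w - p2); last by vec.
    by rewrite h4 addrAC subrr add0r.
have -> : w - z = (u - z) - (u - w) by vec.
by rewrite h1 h3 p20 addr0 addrAC subrr add0r.
Qed.

End meet_cones.

Section type_cone.
Context {R : realType} {L : signature R} (T : theory L) (n : nat).
Local Notation V := (formula L n -> R^o).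
Local Notation S := (@aff_types R L T n).
Local Notation C := (base_cone S).

Lemma base_coneD u v : C u -> C v -> C (u + v).
Proof.
move=> [t [x [t0 Sx ->]]] [s [y [s0 Sy ->]]].
have [ts|ts] := eqVneq (t + s) 0.
  have tE : t = 0 by lra.
  have sE : s = 0 by lra.
  by exists 0, x; split=> //; rewrite tE sE; vec.
have ts0 : 0 < t + s by rewrite lt_neqAle eq_sym ts addr_ge0.
exists (t + s), (fun phi => t / (t + s) * x phi + (1 - t / (t + s)) * y phi).
split; first exact: ltW.
  by apply: aff_types_mix => //; rewrite ?divr_ge0 ?(ltW ts0)// ler_pdivrMr// mul1r lerDl.
by apply: injective_projections; [apply/funext => phi|]; vecE; field.
Qed.

Lemma base_cone_mass u : C u -> u.2 = u.1 (FConst 1).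
Proof. by move=> [t [_ [t0 [M [MT [a ->]]] ->]]]; vecE; rewrite /aff_type /= mulr1. Qed.

Lemma base_cone_ge0 u : C u -> 0 <= u.2.
Proof. by move=> [t [x [t0 _ ->]]]. Qed.

Lemma base_cone_eq0 u : C u -> u.2 = 0 -> u = 0.
Proof. by move=> [t [x [_ _ ->]]] /= ->; rewrite scale0r. Qed.

(** The supremum of the masses of common lower bounds is attained by compactness, once the two
    remainders are recorded along with the lower bound. *)
Lemma base_cone_maximal u v : C u -> C v -> exists w, [/\ C w, C (u - w), C (v - w) &
  forall z, C z -> C (u - z) -> C (v - z) -> z.2 <= w.2].
Proof.
move=> Cu Cv.
have Cu' := Cu; have Cv' := Cv.
move: Cu' Cv' => [alpha [p [alpha0 Sp uE]]] [beta [q [beta0 Sq vE]]].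
pose Mn := [set z | [/\ C z, C (u - z) & C (v - z)]].
have C0 : C 0 by exists 0, p; split=> //; rewrite scale0r.
have Mn0 : Mn 0 by split=> //; rewrite subr0.
pose masses := [set z.2 | z in Mn].
have ub z : Mn z -> z.2 <= alpha /\ z.2 <= beta.
  move=> [_ /base_cone_ge0 h1 /base_cone_ge0 h2]; move: h1 h2.
  by rewrite uE vE /= !subr_ge0.
have hsup : has_sup masses.
  by split; [exists 0, 0|exists alpha => _ [z /ub[h _] <-]].
pose top := sup masses.
pose P := {ptws formula L n -> R}.
(* A point consists of the mass of [w] and of the types carried by [w], [u - w] and [v - w]. The
   masses of the remainders are determined, namely [alpha - t] and [beta - t]. *)
pose K : set (R * (P * (P * P))) := `[0, Num.min alpha beta]%classic `*`
  ((S : set P) `*` ((S : set P) `*` (S : set P))).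
have cK : compact K.
  by do ![apply: compact_setX]; [exact: segment_compact|exact: aff_types_compact..].
pose f (j : formula L n + formula L n) (z : R * (P * (P * P))) : R :=
  match j with
  | inl phi => z.1 * z.2.1 phi + (alpha - z.1) * z.2.2.1 phi - alpha * p phi
  | inr phi => z.1 * z.2.1 phi + (beta - z.1) * z.2.2.2 phi - beta * q phi
  end.
pose D (j : formula L n + formula L n + nat) : set (R * (P * (P * P))) :=
  match j with
  | inl j => f j @^-1` [set 0]
  | inr k => (fun z => z.1) @^-1` [set t | top - k.+1%:R^-1 <= t]
  end.
pose X := (R * (P * (P * P)))%type.
have ct : continuous (fun z : X => z.1) by move=> z; exact: cvg_fst.
have ev phi (g : P) : (fun g : P => g phi) @ g --> g phi by exact: ptws_eval_continuous.
have cx phi : continuous (fun z : X => z.2.1 phi).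
  move=> z; have h1 : (fun z : X => z.2) @ z --> z.2 by exact: cvg_snd.
  have h2 : (fun y : P * (P * P) => y.1) @ z.2 --> z.2.1 by exact: cvg_fst.
  exact: (cvg_comp _ _ (cvg_comp _ _ h1 h2) (ev phi _)).
have cPP (z : X) : (fun z : X => z.2.2) @ z --> z.2.2.
  have h1 : (fun z : X => z.2) @ z --> z.2 by exact: cvg_snd.
  have h2 : (fun y : P * (P * P) => y.2) @ z.2 --> z.2.2 by exact: cvg_snd.
  exact: (cvg_comp _ _ h1 h2).
have cx1 phi : continuous (fun z : X => z.2.2.1 phi).
  move=> z; have h3 : (fun y : P * P => y.1) @ z.2.2 --> z.2.2.1 by exact: cvg_fst.
  exact: (cvg_comp _ _ (cvg_comp _ _ (cPP z) h3) (ev phi _)).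
have cx2 phi : continuous (fun z : X => z.2.2.2 phi).
  move=> z; have h3 : (fun y : P * P => y.2) @ z.2.2 --> z.2.2.2 by exact: cvg_snd.
  exact: (cvg_comp _ _ (cvg_comp _ _ (cPP z) h3) (ev phi _)).
have [||[t [x [x1 x2]]] [/= tK [Sx [Sx1 Sx2]]] hD] := compact_closed_family cK (D := D).
- case=> [j|k]; apply: closed_comp => [z _|]; [|exact: closed_eq|exact: ct|exact: closed_ge].
  have cc (c : R) : (fun _ : X => c) @ z --> c by exact: cvg_cst.
  case: j => phi /=.
  + have g1 := @cvgM R _ (nbhs z) (nbhs_filter z) _ _ _ _ (ct z) (cx phi z).
    have g2 := @cvgM R _ (nbhs z) (nbhs_filter z) _ _ _ _
      (@cvgB R R _ (nbhs z) (nbhs_filter z) (fun=> alpha) _ _ _ (cc alpha) (ct z)) (cx1 phi z).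
    have g3 := @cvgD R R _ (nbhs z) (nbhs_filter z) _ _ _ _ g1 g2.
    exact: (@cvgB R R _ (nbhs z) (nbhs_filter z) _ (fun=> alpha * p phi) _ _ g3 (cc _)).
  + have g1 := @cvgM R _ (nbhs z) (nbhs_filter z) _ _ _ _ (ct z) (cx phi z).
    have g2 := @cvgM R _ (nbhs z) (nbhs_filter z) _ _ _ _
      (@cvgB R R _ (nbhs z) (nbhs_filter z) (fun=> beta) _ _ _ (cc beta) (ct z)) (cx2 phi z).
    have g3 := @cvgD R R _ (nbhs z) (nbhs_filter z) _ _ _ _ g1 g2.
    exact: (@cvgB R R _ (nbhs z) (nbhs_filter z) _ (fun=> beta * q phi) _ _ g3 (cc _)).
- move=> l.
  (* A finite list contains finitely many bounds [top - k.+1%:R^-1], so one [e] serves for all of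
     them. *)
  have [e e0 he] : exists2 e : R, 0 < e & forall z, K z -> (forall j, f j z = 0) ->
      top - e <= z.1 -> foldr (fun j A => D j `&` A) K l z.
    elim: l => [|j l [e e0 IH]]; first by exists 1.
    case: j => [j|k].
      by exists e => // z Kz hz ez; split; [exact: hz|exact: IH].
    exists (Num.min e k.+1%:R^-1); first by rewrite lt_min e0 invr_gt0 ltr0Sn.
    move=> z Kz hz ez; split.
      by apply: le_trans ez; rewrite lerB// ge_min lexx orbT.
    by apply: IH => //; apply: le_trans ez; rewrite lerB// ge_min lexx.
  have [_ [z Mz <-] hz] := sup_adherent e0 hsup.
  have [z1 z2] := ub _ Mz.
  move: Mz hz z1 z2 => [[t [x [t0 Sx ->]]] [t1 [x1 [t10 Sx1 e1]]] [t2 [x2 [t20 Sx2 e2]]]] /= hz z1 z2.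
  exists (t, (x, (x1, x2))); apply: he => /=; last exact: ltW.
    by split=> //=; rewrite in_itv/= t0 le_min z1.
  have E1 : t1 = alpha - t by have := congr1 snd e1; rewrite uE /= => <-.
  have E2 : t2 = beta - t by have := congr1 snd e2; rewrite vE /= => <-.
  move=> [phi|phi] /=.
  + have := congr1 (fun w => w.1 phi) e1; rewrite uE; vecE; rewrite E1 => h.
    by rewrite -[_ * x1 phi]h; ring.
  + have := congr1 (fun w => w.1 phi) e2; rewrite vE; vecE; rewrite E2 => h.
    by rewrite -[_ * x2 phi]h; ring.
have [t0 tle] : 0 <= t /\ (t <= alpha /\ t <= beta).
  by move: tK; rewrite in_itv/= le_min => /andP[-> /andP[-> ->]].
have ttop : top <= t.
  apply/ler_addgt0Pl => e e0.
  have [k] := ltr_add_invr e0; rewrite add0r => hk.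
  have h3 : top - k.+1%:R^-1 <= t := hD (inr k).
  by rewrite lerBlDr in h3; apply: le_trans h3 _; rewrite addrC lerD2r ltW.
have h1 phi : alpha * p phi - t * x phi = (alpha - t) * x1 phi.
  have h : f (inl phi) (t, (x, (x1, x2))) = 0 := hD (inl (inl phi)).
  by apply/eqP; rewrite -subr_eq0 -oppr_eq0 -h /f /=; apply/eqP; ring.
have h2 phi : beta * q phi - t * x phi = (beta - t) * x2 phi.
  have h : f (inr phi) (t, (x, (x1, x2))) = 0 := hD (inl (inr phi)).
  by apply/eqP; rewrite -subr_eq0 -oppr_eq0 -h /f /=; apply/eqP; ring.
exists (t *: x, t); split.
- by exists t, x.
- exists (alpha - t), x1; split=> //; first by rewrite subr_ge0; case: tle.
  rewrite uE; apply: injective_projections => //=.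
  by apply/funext => phi; vecE; exact: h1.
- exists (beta - t), x2; split=> //; first by rewrite subr_ge0; case: tle.
  rewrite vE; apply: injective_projections => //=.
  by apply/funext => phi; vecE; exact: h2.
- move=> z Cz uz vz; apply: le_trans ttop; apply: sup_upper_bound => //.
  by exists z.
Qed.

End type_cone.

(** * The refinement property for measure-preserving systems *)

Section decomposition.
Context {R : realType} {Gamma : groupType}.
Local Notation sig := (@pmp_sig R Gamma).
Local Notation PMP := (PMP R Gamma).

Section relativized_functionals.
Context (M : structure sig) (MP : models M PMP).
Context (n : nat) (v : 'I_n -> M).
Implicit Types phi : formula sig n.

Lemma rfeval_null (e : M) phi : mu e = 0 -> rfeval e phi v = 0.
Proof.
move=> e0; apply/eqP; rewrite -normr_eq0 eq_le normr_ge0 andbT.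
by rewrite (le_trans (rfeval_bound MP _ _ _))// e0 mulr0.
Qed.

Lemma rfeval_one phi : rfeval (one M) phi v = feval phi v.
Proof.
rewrite (feval_split MP (e := one M)) => [|g]; last exact: act_one.
rewrite [X in _ + X]rfeval_null ?addr0//.
by have := mu_modular MP (one M) (neg (one M)); rewrite pcupN// pcapN// mu_one// mu_zero//; lra.
Qed.

Lemma rfeval_base_cone (e : M) (c : R) : 0 <= c -> invariant e ->
  base_cone (@aff_types R sig PMP n) (fun phi => c * rfeval e phi v, c * mu e).
Proof.
move=> c0 ie; have [e0|e0] := eqVneq (mu e) 0.
  exists 0, (aff_type v); split=> //; first by exists M; split=> //; exists v.
  apply: injective_projections => /=; last by rewrite e0 mulr0.
  by apply/funext => phi; rewrite rfeval_null// mulr0 scale0r.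
have {}e0 : 0 < mu e by rewrite lt_neqAle eq_sym e0 mu_ge0.
exists (c * mu e), (fun phi => (mu e)^-1 * rfeval e phi v); split.
- by rewrite mulr_ge0// mu_ge0.
- exact: rfeval_type.
- apply: injective_projections => //=; apply/funext => phi.
  by vecE; rewrite mulrA mulfK// gt_eqF.
Qed.

End relativized_functionals.

Local Notation C n := (base_cone (@aff_types R sig PMP n)).

Lemma base_cone_inj n (u v : (formula sig n -> R^o) * R^o) :
  C n u -> C n v -> u.1 = v.1 -> u = v.
Proof.
move=> /base_cone_mass hu /base_cone_mass hv h.
by apply: injective_projections => //; rewrite hu hv h.
Qed.

(* The decomposition [b + c] is realized by an invariant element [e] of a model,
   and amalgamation extends [a + d] to types that also describe [e]; each of [a]
   and [d] can then be cut along [e] and its complement. *)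
Lemma riesz_decomposition n (a b c d : (formula sig n -> R^o) * R^o) :
  C n a -> C n b -> C n c -> C n d -> a + d = b + c ->
  exists p1 p2 q1 q2, [/\ C n p1, C n p2, C n q1 & C n q2] /\
    [/\ a = p1 + p2, d = q1 + q2, b = p1 + q1 & c = p2 + q2].
Proof.
move=> Ca Cb Cc Cd adbc.
have C0 : C n 0.
  by case: Ca => t [x [_ Sx _]]; exists 0, x; split=> //; rewrite scale0r.
(* A summand of mass 0 is 0 and the refinement is immediate. Positivity of both masses is used below
   to pass invariance to both parts of the amalgam. *)
have [a0|a0] := eqVneq a.2 0.
  have aE := base_cone_eq0 Ca a0; rewrite aE add0r in adbc.
  by exists 0, 0, b, c; rewrite aE addr0 !add0r.
have [d0|d0] := eqVneq d.2 0.
  have dE := base_cone_eq0 Cd d0; rewrite dE addr0 in adbc.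
  by exists b, c, 0, 0; rewrite dE !addr0.
have {}a0 : 0 < a.2 by rewrite lt_neqAle eq_sym a0 (base_cone_ge0 Ca).
have {}d0 : 0 < d.2 by rewrite lt_neqAle eq_sym d0 (base_cone_ge0 Cd).
case: (Ca) (Cb) (Cc) (Cd) => [al [x [al0 Sx aE]]] [be [u [be0 Su bE]]] [ga [w [ga0 Sw cE]]] [de [y [de0 Sy dE]]].
rewrite aE /= in a0; rewrite dE /= in d0.
have mass : al + de = be + ga by have := congr1 snd adbc; rewrite aE bE cE dE.
have val phi : al * x phi + de * y phi = be * u phi + ga * w phi.
  by have := congr1 (fun f => f.1 phi) adbc; rewrite aE bE cE dE; vecE.
pose s := al + de.
have s0 : 0 < s by rewrite addr_gt0.
have sn : s != 0 by rewrite gt_eqF.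
case: Su Sw bE cE val => [N [NP [vb ->]]] [K [KP [vc ->]]] bE cE val.
(* The new variable is [one] over the model of [b] and [zero] over that of [c]: in the mixture it is
   the invariant element separating the two. *)
pose r (psi : formula sig n.+1) : R :=
  be / s * feval psi (extend (one N) vb) + (1 - be / s) * feval psi (extend (zero K) vc).
have ga_s : 1 - be / s = ga / s.
  by rewrite -[1](divff sn) -mulrBl /s mass addrAC subrr add0r.
have de_s : 1 - al / s = de / s.
  by rewrite -[1](divff sn) -mulrBl /s addrAC subrr add0r.
have Sr : aff_types PMP r.
  apply: aff_types_mix.
  - by exists N; split=> //; exists (extend (one N) vb).
  - by exists K; split=> //; exists (extend (zero K) vc).
  - by rewrite divr_ge0// ltW.
  - by rewrite ler_pdivrMr// mul1r /s mass lerDl.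
have [||phi|x' [y' [Sx' Sy' xx' yy' hr]]] := @amalgamation _ _ _ _ _ _ _ (al / s) Sx Sy Sr.
- by rewrite divr_ge0// ltW.
- by rewrite ler_pdivrMr// mul1r /s lerDl.
- rewrite /r !feval_fwk ga_s de_s.
  by have := val phi; rewrite /aff_type => h; rewrite !(mulrAC _ s^-1) -!mulrDl h.
case: Sx' Sy' xx' yy' hr => [Q [QP [v ->]]] [P [PP [z ->]]] xx' yy' hr.
have hr' psi : be * feval psi (extend (one N) vb) + ga * feval psi (extend (zero K) vc) =
    al * feval psi v + de * feval psi z.
  have unscale (p q f g : R) : s * (p / s * f + q / s * g) = p * f + q * g by field.
  by have := congr1 (fun f => s * f) (hr psi); rewrite /r /aff_type ga_s de_s !unscale.
have inv_fixed g : act g (v ord0) = v ord0 /\ act g (z ord0) = z ord0.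
  (* Invariance is the vanishing of a nonnegative formula. Its value at [r] is 0, hence it vanishes
     in each part of positive weight. *)
  pose t : term sig n.+1 := TVar ord0.
  have := hr' (fmu (tsymdiff (tact g t) t)).
  rewrite !feval_fmu !teval_tsymdiff !pmp_tevalE /= !extend0.
  rewrite act_one// act_zero// -!mdist_mu// !mdistxx !mulr0 addr0 => /esym/eqP.
  rewrite paddr_eq0 ?mulr_ge0 ?mdist_ge0// !mulf_eq0 (gt_eqF a0) (gt_eqF d0) => /andP[/eqP h1 /eqP h2].
  by split; apply: mdist_positivity.
have iv : invariant (v ord0) by move=> g; have [] := inv_fixed g.
have iz : invariant (z ord0) by move=> g; have [] := inv_fixed g.
pose v' := v \o lift ord0; pose z' := z \o lift ord0.
pose p1 := (fun phi => al * rfeval (v ord0) phi v', al * mu (v ord0)).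
pose p2 := (fun phi => al * rfeval (neg (v ord0)) phi v', al * mu (neg (v ord0))).
pose q1 := (fun phi => de * rfeval (z ord0) phi z', de * mu (z ord0)).
pose q2 := (fun phi => de * rfeval (neg (z ord0)) phi z', de * mu (neg (z ord0))).
have Cp1 : C n p1 by exact: rfeval_base_cone.
have Cp2 : C n p2 by apply: rfeval_base_cone => //; exact: invariant_neg.
have Cq1 : C n q1 by exact: rfeval_base_cone.
have Cq2 : C n q2 by apply: rfeval_base_cone => //; exact: invariant_neg.
have aE' : a = p1 + p2.
  apply: base_cone_inj => //; first exact: base_coneD.
  apply/funext => phi; rewrite aE /p1 /p2; vecE.
  by rewrite -mulrDr -feval_split// -xx' /aff_type feval_fren.
have dE' : d = q1 + q2.
  apply: base_cone_inj => //; first exact: base_coneD.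
  apply/funext => phi; rewrite dE /q1 /q2; vecE.
  by rewrite -mulrDr -feval_split// -yy' /aff_type feval_fren.
have bE' : b = p1 + q1.
  apply: base_cone_inj => //; first exact: base_coneD.
  apply/funext => phi; rewrite bE /p1 /q1; vecE; rewrite /aff_type.
  (* Relativizing to the new variable gives [phi] itself over [b], where the variable is [one], and
     0 over [c], where it is [zero]; over [v] and [z] it gives [p1] and [q1]. *)
  have := hr' (frelat phi ord0 (lift ord0)).
  rewrite !feval_frelat !extend_lift !extend0 rfeval_one//.
  by rewrite [rfeval (zero K) _ _]rfeval_null ?mu_zero// mulr0 addr0.
exists p1, p2, q1, q2; split=> //; split=> //.
have -> : c = a + d - b by rewrite adbc; vec.
by rewrite aE' dE' bE'; vec.
Qed.

Lemma PMP_simplicial : simplicial PMP.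
Proof.
move=> n; split; [exact: aff_types_compact|exact: aff_types_convex|].
apply: meet_cone_lattice; first exact: base_coneD.
(* An element of the cone provides a type [x], over which 0 can be written as an element of the
   cone. *)
move=> u v Cu; move: (Cu) => [_ [x [_ Sx _]]]; move: v Cu; move: u.
apply: interpolation_meet.
- exact: base_coneD.
- by exists 0, x; split=> //; rewrite scale0r.
- exact: base_cone_ge0.
- exact: base_cone_eq0.
- exact: riesz_decomposition.
- exact: base_cone_maximal.
Qed.

End decomposition.

Theorem theorem28p3 (R : realType) (Gamma : groupType)
    (hGamma : countable [set: Gamma]) :
  (forall M : structure (@pmp_sig R Gamma), models M (PMP R Gamma) ->
     (extremal (PMP R Gamma) M <-> ergodic M)) /\
  simplicial (PMP R Gamma).
Proof.
split; last exact: PMP_simplicial.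
move=> M MP; split; first exact: extremal_ergodic.
exact: ergodic_extremal.
Qed.
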